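(* Let $n\ge3$, let $Z_1\ne Z_2$ be two points of the $n$-dimensional Euclidean space $\mathbb{R}^n$ and $m_1,m_2,f\in\mathbb{R}$. The mechanical billiard system defined in $\mathbb{R}^n$ by the Lagrange problem with force function $m_1/\|q-Z_1\|+m_2/\|q-Z_2\|+f\|q-(Z_1+Z_2)/2\|^2$, with any finite combination (finite union) of confocal quadrics with foci at the two Kepler centers $Z_1,Z_2$ as reflection walls, is integrable. As subcases, the billiard systems with such walls defined by the $n$-dimensional two-center problem ($f=0$), by the $n$-dimensional Kepler problem ($m_1=f=0$ or $m_2=f=0$; one of the foci is then the Kepler center), and by the $n$-dimensional Hooke problem ($m_1=m_2=0$; the quadrics are then centered at the Hooke center) are integrable. In the normalized model $(W^n,\|\cdot\|_a)$, with Kepler centers $\tilde Z_1=(a,0,\dots,0,-1)$, $\tilde Z_2=(-a,0,\dots,0,-1)$ and Hooke center $\tilde Z_0=(0,\dots,0,-1)$, the first integrals are $$E_{sp}=\tfrac12\|\dot{\tilde q}\|_a^2-f\|\tilde q\|_a^2-m_1\|\tilde q-\tilde Z_1\|_a^{-1}-m_2\|\tilde q-\tilde Z_2\|_a^{-1},$$ $$\tilde E_{sph}=\tfrac12\Big(\sum_{i=1}^n\dot q_i^2+\sum_{1\le i<j\le n}(q_i\dot q_j-q_j\dot q_i)^2\Big)-f\sum_{i=1}^nq_i^2-\frac{\hat m_1(1+aq_1)}{\sqrt{(q_1-a)^2+(1+a^2)\sum_{i=2}^nq_i^2}}-\frac{\hat m_2(1-aq_1)}{\sqrt{(q_1+a)^2+(1+a^2)\sum_{i=2}^nq_i^2}},$$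 $$C_k=\sum_{2\le i<j\le k}(q_i\dot q_j-\dot q_iq_j)^2,\qquad 3\le k\le n,$$ where $\hat m_i=m_i\sqrt{1+a^2}$.
   Context: A natural mechanical system $(M,g,U)$ is a Riemannian manifold $(M,g)$ with a force function $U$ (smooth outside a singular set); its motions satisfy $\nabla_{\dot q}\dot q=\mathrm{grad}_g U(q)$. A first integral is a function on $TM$ constant along motions. Poisson brackets of functions on $TM$ are those obtained from the canonical bracket of $T^*M$ via $v\mapsto g(v,\cdot)$. The elastic reflection at a point $q$ of a hypersurface $\mathcal{B}$ sends $v=v_t+v_n$ to $v'=v_t-v_n$ ($v_t$ tangent, $v_n$ $g$-normal to $\mathcal{B}$). The billiard system $(M,g,U,\mathcal{B})$, $\dim M=N$, is integrable if there are $N$ functionally independent first integrals of $(M,g,U)$ (differentials linearly independent on an open dense set), pairwise in involution, each satisfying $F(q,v)=F(q,v')$ for all reflections at $\mathcal{B}$. For a finite union of quadrics, reflections are considered at every point (outside singularities of $U$) of each quadric with respect to the tangent hyperplane of that quadric. A quadric in $\mathbb{R}^n$ (with a given Euclidean norm) is confocal with foci $Z_1,Z_2$ if it is a non-degenerate quadric hypersurface which is the locus of points for which the sum of the distances to $Z_1,Z_2$ is a constant $c>\|Z_1-Z_2\|$ (spheroid), or the absolute value of the difference of these distances is a constant $c$, $0<c<\|Z_1-Z_2\|$ (circular hyperboloid of two sheets). Normalized model: $W^n=\{(q_1,\dots,q_n,-1)\}\subset\mathbb{R}^{n+1}$, $a\neq0$ real, with Euclidean norm $\|\cdot\|_a$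 given by $\|(q_1,\dots,q_n)\|_a=\big(\frac{q_1^2}{1+a^2}+\sum_{i=2}^nq_i^2\big)^{1/2}$ (applied to the first $n$ coordinates); the Lagrange problem in $(W^n,\|\cdot\|_a)$ has force function $m_1\|\tilde q-\tilde Z_1\|_a^{-1}+m_2\|\tilde q-\tilde Z_2\|_a^{-1}+f\|\tilde q-\tilde Z_0\|_a^2$, and distances, gradients and reflections are taken with respect to $\|\cdot\|_a$. Any Lagrange problem in $\mathbb{R}^n$ is brought to this form by a similarity (with rescaled parameters). *)

(* Defs.v *)
From HB Require Import structures.
From mathcomp Require Import all_boot all_order all_algebra.
From mathcomp Require Import all_classical all_reals all_analysis.

Set Implicit Arguments.
Unset Strict Implicit.
Unset Printing Implicit Defensive.

Import Order.TTheory GRing.Theory Num.Theory.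
Import numFieldNormedType.Exports.

Local Open Scope classical_set_scope.
Local Open Scope ring_scope.

Section Smooth.
Variables (R : realType) (V : normedModType R).

Fixpoint Ck (k : nat) (D : set V) (F : V -> R) : Prop :=
  if k is k'.+1 then
    (forall x, D x -> differentiable F x) /\
    (forall w, Ck k' D (fun x => 'd F x w))
  else forall x, D x -> {for x, continuous F}.

Definition smooth_on (D : set V) (F : V -> R) : Prop := forall k, Ck k D F.

End Smooth.

Section Mechanics.
Variables (R : realType) (n : nat).
Local Notation V := 'rV[R]_n.

(* The norm that the library puts on ['rV_n] is the sup norm and only serves
   as a source of topology and differentiability; lengths and angles always
   come from a constant metric, given by its (symmetric positive definite)
   Gram matrix [G]. *)
Definition inner (G : 'M[R]_n) (u w : V) : R := (u *m G *m w^T) 0 0.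

Definition gnorm (G : 'M[R]_n) (u : V) : R := Num.sqrt (inner G u u).

(* [(M, g, U)]; [config] is the open set on which [force] is smooth, that is,
   the complement of the singular set of the force function. *)
Record mech_system := MechSystem {
  config : set V;
  metric : 'M[R]_n;
  force : V -> R }.

(* The vector [u] such that [g(u, w) = dU(q) w] for all [w]. *)
Definition grad (G : 'M[R]_n) (U : V -> R) (q : V) : V :=
  (\row_i 'd U q (delta_mx 0 i)) *m invmx G.

Variable S : mech_system.

(* The pairs (position, velocity). *)
Definition TM : set (V * V) := [set x | config S x.1].

(* The metric being constant, the covariant derivative of the velocity along
   the curve is the second derivative. *)
Definition is_motion (s t : R) (q : R -> V) : Prop :=
  forall u, s < u < t ->
    [/\ config S (q u),
        derivable q u 1,
        derivable (derive1 q) u 1 &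
        derive1 (derive1 q) u = grad (metric S) (force S) (q u)].

Definition first_integral (F : V * V -> R) : Prop :=
  forall (s t : R) (q : R -> V), is_motion s t q ->
    forall u u', s < u < t -> s < u' < t ->
      F (q u, derive1 q u) = F (q u', derive1 q u').

(* Functions of [(q, p)] on the cotangent bundle. *)
Definition canonical_bracket (A B : V * V -> R) (x : V * V) : R :=
  \sum_(i < n) ('d A x (delta_mx 0 i, 0) * 'd B x (0, delta_mx 0 i)
              - 'd A x (0, delta_mx 0 i) * 'd B x (delta_mx 0 i, 0)).

Definition legendre (x : V * V) : V * V := (x.1, x.2 *m metric S).
Definition legendre_inv (x : V * V) : V * V := (x.1, x.2 *m invmx (metric S)).

Definition poisson (F1 F2 : V * V -> R) (x : V * V) : R :=
  canonical_bracket (F1 \o legendre_inv) (F2 \o legendre_inv) (legendre x).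

Definition lin_indep_differentials (F : 'I_n -> V * V -> R) (x : V * V) : Prop :=
  forall c : 'I_n -> R,
    (forall w : V * V, \sum_(i < n) c i * 'd (F i) x w = 0) ->
    forall i, c i = 0.

Definition functionally_independent (F : 'I_n -> V * V -> R) : Prop :=
  exists O : set (V * V),
    [/\ open O, O `<=` TM, TM `<=` closure O &
        forall x, O x -> lin_indep_differentials F x].

(* Velocities at [q] of the curves drawn on the hypersurface [B]. *)
Definition tangent (B : set V) (q : V) : set V :=
  [set w | exists gamma : R -> V,
    [/\ gamma 0 = q, \forall t \near (0 : R), B (gamma t) &
        is_derive (0 : R) 1 gamma w]].

Definition reflection (B : set V) (q v v' : V) : Prop :=
  exists vt vn : V,
    [/\ tangent B q vt,
        forall w, tangent B q w -> inner (metric S) vn w = 0,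
        v = vt + vn & v' = vt - vn].

Definition reflection_invariant (B : set V) (F : V * V -> R) : Prop :=
  forall q v v', config S q -> B q -> reflection B q v v' ->
    F (q, v) = F (q, v').

(* The walls are the union of the [B i], each reflecting with respect to its
   own tangent hyperplanes. *)
Definition integrates (k : nat) (B : 'I_k -> set V) (F : 'I_n -> V * V -> R) :
    Prop :=
  [/\ forall i, smooth_on TM (F i),
      forall i, first_integral (F i),
      functionally_independent F,
      forall i j x, TM x -> poisson (F i) (F j) x = 0 &
      forall i j, reflection_invariant (B j) (F i)].

Definition integrable_billiard (k : nat) (B : 'I_k -> set V) : Prop :=
  exists F : 'I_n -> V * V -> R, integrates B F.

End Mechanics.

Section Quadrics.
Variables (R : realType) (n : nat).
Local Notation V := 'rV[R]_n.

(* Zero set of a quadratic polynomial, homogenized by a last coordinate equal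
   to 1; non-degeneracy is that of the homogenized quadratic form. *)
Definition nondegenerate_quadric (B : set V) : Prop :=
  exists Q : 'M[R]_(n + 1),
    [/\ Q^T = Q, Q \in unitmx &
        B = [set q | (row_mx q 1%:M *m Q *m (row_mx q 1%:M)^T) 0 0 = 0]].

Variables (G : 'M[R]_n) (Z1 Z2 : V).
Let dist (p q : V) : R := gnorm G (p - q).

Definition spheroid (c : R) : set V :=
  [set q | dist q Z1 + dist q Z2 = c].

Definition circular_hyperboloid (c : R) : set V :=
  [set q | `|dist q Z1 - dist q Z2| = c].

Definition confocal_quadric (B : set V) : Prop :=
  nondegenerate_quadric B /\
  ((exists2 c, dist Z1 Z2 < c & B = spheroid c) \/
   (exists2 c, 0 < c < dist Z1 Z2 & B = circular_hyperboloid c)).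

End Quadrics.

Section Lagrange.
Variables (R : realType) (n : nat).
Local Notation V := 'rV[R]_n.

(* A center is singular only when its mass is nonzero. *)
Definition kepler_sing (m : R) (Z : V) : set V :=
  [set q | m != 0 /\ q = Z].

Definition lagrange_system (G : 'M[R]_n) (m1 m2 f : R) (Z1 Z2 Z0 : V) : mech_system R n :=
  MechSystem (~` (kepler_sing m1 Z1 `|` kepler_sing m2 Z2)) G
    (fun q => m1 / gnorm G (q - Z1) + m2 / gnorm G (q - Z2)
              + f * gnorm G (q - Z0) ^+ 2).

Definition two_center_system (G : 'M[R]_n) (m1 m2 : R) (Z1 Z2 : V) : mech_system R n :=
  MechSystem (~` (kepler_sing m1 Z1 `|` kepler_sing m2 Z2)) G
    (fun q => m1 / gnorm G (q - Z1) + m2 / gnorm G (q - Z2)).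

Definition kepler_system (G : 'M[R]_n) (m : R) (Z : V) : mech_system R n :=
  MechSystem (~` kepler_sing m Z) G (fun q => m / gnorm G (q - Z)).

Definition hooke_system (G : 'M[R]_n) (f : R) (Z0 : V) : mech_system R n :=
  MechSystem setT G (fun q => f * gnorm G (q - Z0) ^+ 2).

Definition euclidean : 'M[R]_n := 1%:M.

Definition midpoint (Z1 Z2 : V) : V := 2^-1 *: (Z1 + Z2).

End Lagrange.

(* [W^n] is identified with R^n by its first [n] coordinates (the last one is
   constantly -1).  Ordinals start at 0, so that [q 0 i] is the coordinate
   [q_(i+1)]. *)
Section Normalized.
Variables (R : realType) (n : nat) (n_ge3 : (3 <= n)%N).
Local Notation V := 'rV[R]_n.
Variable a : R.

Definition ord_first : 'I_n := Ordinal (leq_trans (isT : (0 < 3)%N) n_ge3).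

Definition metric_a : 'M[R]_n :=
  diag_mx (\row_i (if i == ord_first then (1 + a ^+ 2)^-1 else 1)).

Definition norm_a (u : V) : R := gnorm metric_a u.

Definition Zt1 : V := \row_i (if i == ord_first then a else 0).
Definition Zt2 : V := \row_i (if i == ord_first then - a else 0).
Definition Zt0 : V := 0.

Definition normalized_lagrange (m1 m2 f : R) : mech_system R n :=
  lagrange_system metric_a m1 m2 f Zt1 Zt2 Zt0.

Definition E_sp (m1 m2 f : R) (x : V * V) : R :=
  let: (q, v) := x in
  2^-1 * norm_a v ^+ 2 - f * norm_a q ^+ 2
  - m1 / norm_a (q - Zt1) - m2 / norm_a (q - Zt2).

Definition E_sph (m1 m2 f : R) (x : V * V) : R :=
  let: (q, v) := x in
  let q1 := q 0 ord_first in
  let mh1 := m1 * Num.sqrt (1 + a ^+ 2) in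
  let mh2 := m2 * Num.sqrt (1 + a ^+ 2) in
  let rho := \sum_(i < n | i != ord_first) q 0 i ^+ 2 in
  2^-1 * (\sum_(i < n) v 0 i ^+ 2
          + \sum_(i < n) \sum_(j < n | (i < j)%N)
              (q 0 i * v 0 j - q 0 j * v 0 i) ^+ 2)
  - f * \sum_(i < n) q 0 i ^+ 2
  - mh1 * (1 + a * q1) / Num.sqrt ((q1 - a) ^+ 2 + (1 + a ^+ 2) * rho)
  - mh2 * (1 - a * q1) / Num.sqrt ((q1 + a) ^+ 2 + (1 + a ^+ 2) * rho).

(* The sum over [2 <= i < j <= k], in 1-based indices. *)
Definition C_int (k : nat) (x : V * V) : R :=
  let: (q, v) := x in
  \sum_(i < n | (1 <= i)%N) \sum_(j < n | (i < j < k)%N)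
    (q 0 i * v 0 j - v 0 i * q 0 j) ^+ 2.

(* [E_sp], [E_sph], [C_3], ..., [C_n]. *)
Definition lagrange_integrals (m1 m2 f : R) (i : 'I_n) : V * V -> R :=
  match val i with
  | 0 => E_sp m1 m2 f
  | 1 => E_sph m1 m2 f
  | k.+2 => C_int k.+3
  end.

End Normalized.

(* Main.v *)
Require Import Defs.
From HB Require Import structures.
From mathcomp Require Import all_boot all_order all_algebra.
From mathcomp Require Import all_classical all_reals all_analysis.
From mathcomp Require Import ring lra.

Set Implicit Arguments.
Unset Strict Implicit.
Unset Printing Implicit Defensive.

Import Order.TTheory GRing.Theory Num.Theory.
Import numFieldNormedType.Exports.

Local Open Scope classical_set_scope.
Local Open Scope ring_scope.

(* In an orthonormal frame centered at the midpoint of the foci and with first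
   axis through them, let y, w be the coordinates of position and velocity and
   put rho_k = sum y_i^2, sig_k = sum y_i w_i, tau_k = sum w_i^2 over the
   non-axial indices below k.  Every first integral is a function of
   (y_0, w_0, rho_k, sig_k, tau_k), with C_k = rho_k tau_k - sig_k^2.  The three
   sums span a Lie algebra sl_2 under the bracket, C_k is its Casimir, and it
   commutes with rho_l, sig_l, tau_l for k <= l; so the only bracket left to
   compute is {E_sp, E_sph}, an identity between rational functions of the five
   reduced variables and the two distances to the centers.  Conservation
   follows, since the derivative of F along a motion is {F, E_sp}.
   The differentials are independent already in the velocity directions, where
   the integrals are quadratic: the minors are polynomials which do not vanish
   identically, hence are nonzero on a dense open set.
   Both kinds of confocal quadrics satisfy
     kap y_0^2 + rho_n = K   with   kap = 1 - 4 d^2 / h^2, (1 - kap) K = kap d^2,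
   where 2 d is the distance of the foci and h the sum or difference of the
   distances to them; the last relation makes tangent and normal vectors
   conjugate for the quadratic form of E_sph. *)

(** * Smooth functions *)

Section SmoothCalculus.
Variables (R : realType) (V : normedModType R).
Implicit Types (F G : V -> R) (dF dG : V -> R) (D : set V) (x : V).

(** The little-o expansion and the uniqueness of the differential only involve the germ at [x]. This
    serves both to alter a function off an open set and to compare two expressions of one function
    near a point. *)
Lemma near_eq_is_diff x F G dF :
  (\near x, F x = G x) -> is_diff x F dF -> is_diff x G dF.
Proof.
move=> FG [dFx dFE].
have FGx : F x = G x := nbhs_singleton FG.
have cdF : continuous ('d F x) by exact: diff_continuous.
have loc : G \o shift x = cst (G x) + 'd F x +o_ 0 id.
  apply/eqaddoP => e e0.
  have /eqaddoP /(_ _ e0) FE := diff_locally dFx.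
  have FG0 : \forall h \near 0, F (h + x) = G (h + x).
    by move: FG; rewrite (near_shift 0 x) subr0.
  near=> h.
  have : `|(F \o shift x - (cst (F x) + 'd F x)) h| <= e * `|id h|.
    by near: h.
  have FGh : F (h + x) = G (h + x) by near: h.
  by rewrite /= !fctE /= FGh /cst FGx.
have dGE : 'd G x = 'd F x :> (V -> R) by exact: diff_unique.
split; last by rewrite dGE.
by apply/diff_locallyP; rewrite dGE.
Unshelve. all: by end_near. Qed.

Lemma is_diffD_pt x F G dF dG : is_diff x F dF -> is_diff x G dG ->
  is_diff x (fun y => F y + G y) (fun h => dF h + dG h).
Proof. by move=> *; exact: is_diffD. Qed.

Lemma is_diffM_pt x F G dF dG : is_diff x F dF -> is_diff x G dG ->
  is_diff x (fun y => F y * G y) (fun h => F x * dG h + G x * dF h).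
Proof. by move=> *; exact: is_diffM. Qed.

Lemma is_diff_const x (a : R) : is_diff x (fun=> a) (fun=> 0).
Proof. exact: is_diff_cst. Qed.

(** The derivative is written with the cube of the inverse root itself: this closes the induction in
    [Ck_sqrtV] and makes the factor [kepler3] of the Kepler gradients appear directly. *)
Lemma is_diff_sqrtV x F dF : 0 < F x -> is_diff x F dF ->
  is_diff x (fun y => (Num.sqrt (F y))^-1)
            (fun h => - 2^-1 * (Num.sqrt (F x))^-1 ^+ 3 * dF h).
Proof.
move=> F0 dFx; have s0 : Num.sqrt (F x) != 0 by rewrite gt_eqF ?sqrtr_gt0.
have ds : is_diff (F x) Num.sqrt (fun h : R => h * (2 * Num.sqrt (F x))^-1).
  have [ds1 ds2] : is_derive (F x) 1 Num.sqrt _ := is_derive1_sqrt F0.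
  have ds3 : differentiable (Num.sqrt : R -> R) (F x).
    by apply/derivable1_diffP; exact: ds1.
  split=> //; rewrite (diff1E ds3); apply/funext => h; congr (_ * _).
  by rewrite derive1E ds2.
have dsF := is_diff_comp dFx ds.
split; first by apply: differentiableV => //; case: dsF.
rewrite (@diffV _ _ (Num.sqrt \o F)) //.
have -> : 'd (fun y => Num.sqrt (F y)) x =
    (fun h : R => h * (2 * Num.sqrt (F x))^-1) \o dF :> (V -> R).
  exact: diff_val.
apply/funext => h /=; rewrite /GRing.scale /=; field.
by rewrite s0.
Qed.

Lemma Ck_ext k D F G : open D -> (forall x, D x -> F x = G x) ->
  Ck k D F -> Ck k D G.
Proof.
move=> oD; elim: k F G => [|k IH] F G FG /=.
  move=> cF x Dx; have nD : \near x, F x = G x.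
    by near do apply: FG; apply: open_nbhs_nbhs.
  rewrite /prop_for /continuous_at -(FG _ Dx).
  exact: cvg_trans (near_eq_cvg nD) (cF x Dx).
have H x : D x -> (forall x, D x -> differentiable F x) -> is_diff x G ('d F x).
  move=> Dx dF; apply: near_eq_is_diff; last exact: differentiableP (dF x Dx).
  by near do apply: FG; apply: open_nbhs_nbhs.
move=> [dF CdF]; split=> [x Dx|w]; first by case: (H x Dx dF).
apply: IH (CdF w) => x Dx.
by have [_ ->] := H x Dx dF.
Unshelve. all: by end_near. Qed.

(** An explicit formula for the differential, valid on [D] only, suffices: by [Ck_ext] the values
    off the open set do not matter. *)
Lemma Ck_S k D F (dF : V -> V -> R) : open D ->
  (forall x, D x -> is_diff x F (dF x)) ->
  (forall w, Ck k D (fun x => dF x w)) -> Ck k.+1 D F.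
Proof.
move=> oD dFE CdF; split=> [x Dx|w]; first by case: (dFE x Dx).
by apply: Ck_ext (CdF w) => // x Dx; case: (dFE x Dx) => _ ->.
Qed.

Lemma CkW k D F : Ck k.+1 D F -> Ck k D F.
Proof.
elim: k F => [|k IH] F [dF CdF].
  by move=> x Dx; exact: differentiable_continuous (dF x Dx).
by split=> // w; apply: IH.
Qed.

Lemma Ck_is_diff k D F x : Ck k.+1 D F -> D x -> is_diff x F ('d F x).
Proof. by move=> [dF _] Dx; apply: differentiableP; apply: dF. Qed.

Lemma Ck_const k D (a : R) : open D -> Ck k D (fun=> a).
Proof.
move=> oD; elim: k a => [|k IH] a; first by move=> x _; exact: cst_continuous.
by apply: (@Ck_S _ _ _ (fun _ _ => 0)) => // x _; exact: is_diff_const.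
Qed.

Lemma CkD k D F G : open D -> Ck k D F -> Ck k D G ->
  Ck k D (fun x => F x + G x).
Proof.
move=> oD; elim: k F G => [|k IH] F G CF CG.
  by move=> x Dx; apply: cvgD; [exact: CF|exact: CG].
apply: (@Ck_S _ _ _ (fun x w => 'd F x w + 'd G x w)) => // [x Dx|w].
  by apply: is_diffD_pt; [exact: Ck_is_diff CF Dx|exact: Ck_is_diff CG Dx].
by apply: IH; [exact: CF.2|exact: CG.2].
Qed.

Lemma CkM k D F G : open D -> Ck k D F -> Ck k D G ->
  Ck k D (fun x => F x * G x).
Proof.
move=> oD; elim: k F G => [|k IH] F G CF CG.
  by move=> x Dx; apply: cvgM; [exact: CF|exact: CG].
apply: (@Ck_S _ _ _ (fun x w => F x * 'd G x w + G x * 'd F x w)) => // [x Dx|w].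
  by apply: is_diffM_pt; [exact: Ck_is_diff CF Dx|exact: Ck_is_diff CG Dx].
by apply: CkD => //; apply: IH; by [exact: CkW|exact: CF.2|exact: CG.2].
Qed.

(** Bootstrap: the differential is a product of ['d F] and a power of the inverse root, so
    regularity [k] of the inverse root yields regularity [k.+1]. *)
Lemma Ck_sqrtV k D F : open D -> (forall x, D x -> 0 < F x) -> Ck k D F ->
  Ck k D (fun x => (Num.sqrt (F x))^-1).
Proof.
move=> oD F0; elim: k => [|k IH] CF.
  move=> x Dx; apply: cvgV; first by rewrite gt_eqF ?sqrtr_gt0 ?F0.
  by apply: continuous_comp; [exact: CF|exact: sqrt_continuous].
have Cs := IH (CkW CF).
apply: (@Ck_S _ _ _
    (fun x w => - 2^-1 * (Num.sqrt (F x))^-1 ^+ 3 * 'd F x w)) => // [x Dx|w].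
  by apply: is_diff_sqrtV; [exact: F0|exact: Ck_is_diff CF Dx].
apply: CkM => //; last exact: CF.2.
apply: CkM => //; first exact: Ck_const.
exact: (CkM oD Cs (CkM oD Cs Cs)).
Qed.

Lemma smoothD D F G : open D -> smooth_on D F -> smooth_on D G ->
  smooth_on D (fun x => F x + G x).
Proof. by move=> oD CF CG k; apply: CkD. Qed.

Lemma smoothM D F G : open D -> smooth_on D F -> smooth_on D G ->
  smooth_on D (fun x => F x * G x).
Proof. by move=> oD CF CG k; apply: CkM. Qed.

Lemma smoothB D F G : open D -> smooth_on D F -> smooth_on D G ->
  smooth_on D (fun x => F x - G x).
Proof.
move=> oD sF sG; rewrite (_ : (fun _ => _) = fun x => F x + (-1) * G x).
  by apply: (smoothD oD sF) => k; apply: CkM oD (Ck_const _ _ oD) (sG k).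
by apply/funext => x; rewrite mulN1r.
Qed.

Lemma smooth_const D (a : R) : open D -> smooth_on D (fun=> a).
Proof. by move=> oD k; apply: Ck_const. Qed.

Lemma smooth_sqrtV D F : open D -> (forall x, D x -> 0 < F x) ->
  smooth_on D F -> smooth_on D (fun x => (Num.sqrt (F x))^-1).
Proof. by move=> oD F0 CF k; apply: Ck_sqrtV. Qed.

Lemma smooth_sum D (I : Type) (r : seq I) (P : pred I) (F : I -> V -> R) :
  open D -> (forall i, smooth_on D (F i)) ->
  smooth_on D (fun x => \sum_(i <- r | P i) F i x).
Proof.
move=> oD CF; elim: r => [|i r IH].
  rewrite (_ : (fun _ => _) = fun=> 0); first exact: smooth_const.
  by apply/funext => x; rewrite big_nil.
case Pi: (P i).
  rewrite (_ : (fun _ => _) = fun x => F i x + \sum_(i <- r | P i) F i x).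
    exact: smoothD.
  by apply/funext => x; rewrite big_cons Pi.
rewrite (_ : (fun _ => _) = fun x => \sum_(i <- r | P i) F i x) //.
by apply/funext => x; rewrite big_cons Pi.
Qed.

Lemma smooth_prod D (I : Type) (r : seq I) (P : pred I) (F : I -> V -> R) :
  open D -> (forall i, smooth_on D (F i)) ->
  smooth_on D (fun x => \prod_(i <- r | P i) F i x).
Proof.
move=> oD CF; elim: r => [|i r IH].
  rewrite (_ : (fun _ => _) = fun=> 1); first exact: smooth_const.
  by apply/funext => x; rewrite big_nil.
case Pi: (P i).
  rewrite (_ : (fun _ => _) = fun x => F i x * \prod_(i <- r | P i) F i x).
    exact: smoothM.
  by apply/funext => x; rewrite big_cons Pi.
rewrite (_ : (fun _ => _) = fun x => \prod_(i <- r | P i) F i x) //.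
by apply/funext => x; rewrite big_cons Pi.
Qed.

(** The differential is the same at every point, so its value in a fixed direction is a constant
    function. *)
Lemma smooth_affine D F dF : open D -> (forall x, is_diff x F dF) ->
  smooth_on D F.
Proof.
move=> oD dFE [|k].
  by move=> x _; apply: differentiable_continuous; case: (dFE x).
by apply: (@Ck_S _ _ _ (fun _ => dF)) => // w; apply: Ck_const.
Qed.

End SmoothCalculus.

(** * Orthonormal frames *)

Lemma is_diff_linear (R : realType) (U : normedModType R) (g : U -> R) (x : U) :
  linear g -> continuous g -> is_diff x g g.
Proof.
move=> lin cg.
pose gM := GRing.isLinear.Build _ _ _ _ _ lin.
pose gL : {linear U -> R} := HB.pack g gM.
split; first exact: (@linear_differentiable _ _ _ gL).
exact: (@diff_lin _ _ _ gL).
Qed.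

Lemma mulmxr_continuous (R : realType) (m n : nat) (A : 'M[R]_(m, n)) :
  continuous (mulmxr A : 'rV[R]_m -> 'rV[R]_n).
Proof.
rewrite (_ : mulmxr A = fun u : 'rV_m => \sum_j u 0 j *: row j A :> 'rV_n).
  apply: (continuous_big (@add_continuous 'rV[R]_n)) => j _ u.
  exact: (continuous_comp (@coord_continuous _ _ _ 0 j u)
            (@scalel_continuous _ _ (row j A) (u 0 j))).
by apply/funext => u; exact: mulmx_sum_row.
Qed.

Section Frame.
Variables (R : realType) (n : nat) (P : 'M[R]_n).
Local Notation V := 'rV[R]_n.

(* Coordinates in the frame formed by the rows of [P]; [dotk] leaves out the
   axial coordinate, whose index is 0. *)
Definition co (u : V) (i : 'I_n) : R := (u *m invmx P) 0 i.

Definition dotk (k : nat) (u w : V) : R :=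
  \sum_(i < n | (0 < i < k)%N) co u i * co w i.

Lemma co_linear i : linear (co^~ i : V -> R^o).
Proof. by move=> a u w; rewrite /co mulmxDl -scalemxAl !mxE. Qed.

Lemma coD u w i : co (u + w) i = co u i + co w i.
Proof. by rewrite /co mulmxDl mxE. Qed.

Lemma coZ a u i : co (a *: u) i = a * co u i.
Proof. by rewrite /co -scalemxAl mxE. Qed.

Lemma coN u i : co (- u) i = - co u i.
Proof. by rewrite /co mulNmx mxE. Qed.

Lemma coB u w i : co (u - w) i = co u i - co w i.
Proof. by rewrite coD coN. Qed.

Lemma co0 i : co 0 i = 0.
Proof. by rewrite /co mul0mx mxE. Qed.

Lemma dotkC k u w : dotk k u w = dotk k w u.
Proof. by apply: eq_bigr => i _; rewrite mulrC. Qed.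

Lemma dotkDl k u u' w : dotk k (u + u') w = dotk k u w + dotk k u' w.
Proof. by rewrite -big_split; apply: eq_bigr => i _; rewrite coD mulrDl. Qed.

Lemma dotkDr k u w w' : dotk k u (w + w') = dotk k u w + dotk k u w'.
Proof. by rewrite dotkC dotkDl !(dotkC _ u). Qed.

Lemma dotkZl k a u w : dotk k (a *: u) w = a * dotk k u w.
Proof. by rewrite mulr_sumr; apply: eq_bigr => i _; rewrite coZ mulrA. Qed.

Lemma dotkZr k a u w : dotk k u (a *: w) = a * dotk k u w.
Proof. by rewrite dotkC dotkZl dotkC. Qed.

Lemma dotkNl k u w : dotk k (- u) w = - dotk k u w.
Proof. by rewrite -scaleN1r dotkZl mulN1r. Qed.

Lemma dotkNr k u w : dotk k u (- w) = - dotk k u w.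
Proof. by rewrite dotkC dotkNl dotkC. Qed.

Lemma dotk_ge0 k u : 0 <= dotk k u u.
Proof. by apply: sumr_ge0 => i _; rewrite -expr2 sqr_ge0. Qed.

Lemma co_continuous i : continuous (co^~ i : V -> R^o).
Proof.
rewrite (_ : co^~ i = fun u : V => \sum_j u 0 j * invmx P j i).
  apply: (continuous_big (@add_continuous R^o)) => j _ u.
  exact: (continuous_comp (@coord_continuous _ _ _ 0 j u)
            (@scalel_continuous _ R^o (invmx P j i) (u 0 j))).
by apply/funext => w; rewrite /co mxE.
Qed.

Lemma is_diff_co u i : is_diff u (co^~ i) (co^~ i).
Proof. exact: is_diff_linear (@co_linear i) (@co_continuous i). Qed.

Lemma is_diff_fst (U W : normedModType R) (x : U * W) : is_diff x fst fst.
Proof.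
split; last by apply: (@diff_lin _ _ _ fst) => y; exact: cvg_fst.
by apply: linear_differentiable => y; exact: cvg_fst.
Qed.

Lemma is_diff_snd (U W : normedModType R) (x : U * W) : is_diff x snd snd.
Proof.
split; last by apply: (@diff_lin _ _ _ snd) => y; exact: cvg_snd.
by apply: linear_differentiable => y; exact: cvg_snd.
Qed.

Lemma is_diff_pos c (x : V * V) i :
  is_diff x (fun y => co (y.1 - c) i) (fun h => co h.1 i).
Proof.
have -> : (fun y : V * V => co (y.1 - c) i) =
    (fun y => (co^~ i \o fst) y + (- co c i)).
  by apply/funext => y /=; rewrite coB.
apply: is_diff_eq.
  apply: is_diffD_pt (is_diff_const _ _).
  exact: is_diff_comp (is_diff_fst _) (is_diff_co _ _).
by apply/funext => h /=; rewrite addr0.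
Qed.

Lemma is_diff_vel (x : V * V) i :
  is_diff x (fun y => co y.2 i) (fun h => co h.2 i).
Proof. exact: is_diff_comp (is_diff_snd _) (is_diff_co _ _). Qed.

Lemma is_diff_sum (U : normedModType R) (I : Type) (r : seq I) (p : pred I)
    (F dF : I -> U -> R) x :
  (forall i, is_diff x (F i) (dF i)) ->
  is_diff x (fun y => \sum_(i <- r | p i) F i y)
            (fun h => \sum_(i <- r | p i) dF i h).
Proof.
move=> H; elim: r => [|i r IH].
  have -> : (fun y : U => \sum_(i <- [::] | p i) F i y) = fun=> 0.
    by apply/funext => y; rewrite big_nil.
  apply: is_diff_eq (is_diff_const _ _) _.
  by apply/funext => y; rewrite big_nil.
case pi: (p i).
  have -> : (fun y : U => \sum_(i <- i :: r | p i) F i y) =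
            fun y => F i y + \sum_(i <- r | p i) F i y.
    by apply/funext => y; rewrite big_cons pi.
  apply: is_diff_eq (is_diffD_pt (H i) IH) _.
  by apply/funext => y; rewrite big_cons pi.
have -> : (fun y : U => \sum_(i <- i :: r | p i) F i y) =
          fun y => \sum_(i <- r | p i) F i y.
  by apply/funext => y; rewrite big_cons pi.
apply: is_diff_eq IH _.
by apply/funext => y; rewrite big_cons pi.
Qed.

Variable G : 'M[R]_n.
Hypothesis PGP : P *m G *m P^T = 1%:M.

Lemma frame_unit : P \in unitmx.
Proof. by have [] := mulmx1_unit (etrans (mulmxA _ _ _) PGP). Qed.

Lemma metric_frame : G = invmx P *m (invmx P)^T.
Proof.
have uP := frame_unit; have uPT : P^T \in unitmx by rewrite unitmx_tr.
by rewrite trmx_inv -[invmx P]mulmx1 -PGP !mulmxA mulVmx // mul1mx mulmxK.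
Qed.

Lemma invmx_metric : invmx G = P^T *m P.
Proof.
have uP := frame_unit; have uPT : P^T \in unitmx by rewrite unitmx_tr.
have GK : G *m (P^T *m P) = 1%:M.
  by rewrite metric_frame trmx_inv mulmxA mulmxKV // mulVmx.
have [uG _] := mulmx1_unit GK.
by apply: (can_inj (mulKmx uG)); rewrite GK mulmxV.
Qed.

Lemma co_frame (y : V) i : co (y *m P) i = y 0 i.
Proof. by rewrite /co mulmxK // frame_unit. Qed.

Lemma co_inj u w : (forall i, co u i = co w i) -> u = w.
Proof.
move=> H; rewrite -(mulmxKV frame_unit u) -(mulmxKV frame_unit w).
by congr (_ *m _); apply/rowP => i; exact: H.
Qed.

Lemma inner_co u w : inner G u w = \sum_i co u i * co w i.
Proof.
rewrite /inner metric_frame mulmxA -mulmxA -trmx_mul mxE.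
by apply: eq_bigr => i _; rewrite [X in _ * X]mxE.
Qed.

(** Passing to the frame is a canonical change of variables: positions are multiplied by the inverse
    of [P], and, as the inverse metric is [P^T *m P], momenta are multiplied by [P^T]. The two
    matrices cancel in the bracket. *)
Lemma poisson_frame (S : mech_system R n) F1 F2 x (A1 B1 A2 B2 : 'I_n -> R) :
  metric S = G ->
  is_diff x F1 (fun h => \sum_i A1 i * co h.1 i + \sum_i B1 i * co h.2 i) ->
  is_diff x F2 (fun h => \sum_i A2 i * co h.1 i + \sum_i B2 i * co h.2 i) ->
  poisson S F1 F2 x = \sum_i (A1 i * B2 i - B1 i * A2 i).
Proof.
move=> SG dF1 dF2.
have legK : legendre_inv S (legendre S x) = x.
  rewrite /legendre_inv /legendre SG /= invmx_metric metric_frame -!mulmxA.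
  rewrite trmx_inv (mulmxA (invmx P^T)) mulVmx ?unitmx_tr ?frame_unit //.
  by rewrite mul1mx mulVmx ?frame_unit // mulmx1; case: x {dF1 dF2}.
have dleg : is_diff (legendre S x) (legendre_inv S) (legendre_inv S).
  have dm u : is_diff u (mulmxr (invmx (metric S)) : V -> V)
                        (mulmxr (invmx (metric S))).
    have lc := @mulmxr_continuous R _ _ (invmx (metric S)).
    split; last exact: (@diff_lin _ _ _ (mulmxr (invmx (metric S)))).
    exact: (@linear_differentiable _ _ _ (mulmxr (invmx (metric S)))).
  exact: (is_diff_pair (is_diff_fst _) (is_diff_comp (is_diff_snd _) (dm _))).
have dq F A B i : is_diff x F
     (fun h => \sum_i A i * co h.1 i + \sum_i B i * co h.2 i) ->
    'd (F \o legendre_inv S) (legendre S x) (delta_mx 0 i, 0)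
       = \sum_j A j * invmx P i j.
  move=> dF; have dF' : is_diff (legendre_inv S (legendre S x)) F
      (fun h => \sum_i A i * co h.1 i + \sum_i B i * co h.2 i) by rewrite legK.
  have [_ ->] := is_diff_comp dleg dF'.
  rewrite /= mul0mx [X in _ + X]big1 ?addr0; last first.
    by move=> j _; rewrite co0 mulr0.
  by apply: eq_bigr => j _; rewrite /co -rowE mxE.
have dp F A B i : is_diff x F
     (fun h => \sum_i A i * co h.1 i + \sum_i B i * co h.2 i) ->
    'd (F \o legendre_inv S) (legendre S x) (0, delta_mx 0 i)
       = \sum_j B j * P j i.
  move=> dF; have dF' : is_diff (legendre_inv S (legendre S x)) F
      (fun h => \sum_i A i * co h.1 i + \sum_i B i * co h.2 i) by rewrite legK.
  have [_ ->] := is_diff_comp dleg dF'.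
  rewrite /= [X in X + _]big1 ?add0r; last first.
    by move=> j _; rewrite co0 mulr0.
  apply: eq_bigr => j _; rewrite SG invmx_metric /co !mulmxA mulmxK ?frame_unit //.
  by rewrite -rowE !mxE.
have dual (A B : 'I_n -> R) : \sum_i (\sum_j A j * invmx P i j) * (\sum_j B j * P j i)
    = \sum_i A i * B i.
  under eq_bigr do rewrite mulr_suml.
  rewrite exchange_big /=; apply: eq_bigr => j _.
  under eq_bigr do rewrite mulr_sumr.
  rewrite exchange_big /=.
  transitivity (\sum_k A j * B k * (P *m invmx P) k j).
    apply: eq_bigr => k _; rewrite mxE mulr_sumr; apply: eq_bigr => i _; ring.
  rewrite mulmxV ?frame_unit // (bigD1 j) //= mxE eqxx mulr1 big1 ?addr0 //.
  by move=> k /negPf kj; rewrite mxE kj mulr0.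
rewrite /poisson /canonical_bracket.
under eq_bigr do
  rewrite (dq _ _ _ _ dF1) (dp _ _ _ _ dF2) (dp _ _ _ _ dF1) (dq _ _ _ _ dF2).
rewrite big_split /= sumrN dual.
under [X in _ - X]eq_bigr do rewrite mulrC.
rewrite dual -sumrB; apply: eq_bigr => i _; ring.
Qed.

End Frame.

(** * Functions of the reduced variables *)

Section Reduced.
Variables (R : realType) (n : nat) (n_ge3 : (3 <= n)%N) (P : 'M[R]_n).
Variable c : 'rV[R]_n.
Local Notation V := 'rV[R]_n.
Local Notation o := (ord_first n_ge3).
Local Notation co := (co P).
Local Notation dotk := (dotk P).

Lemma ord_firstE (i : 'I_n) : (i != o) = (0 < i)%N.
Proof. by rewrite -val_eqE /= lt0n. Qed.

Lemma sum_axis (F : 'I_n -> R) k : (0 < k)%N ->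
  \sum_(i < n | (i < k)%N) F i = F o + \sum_(i < n | (0 < i < k)%N) F i.
Proof.
move=> k0; rewrite (bigD1 o) //=; congr (_ + _).
by apply: eq_bigl => i; rewrite ord_firstE andbC.
Qed.

Lemma sum_axisT (F : 'I_n -> R) :
  \sum_i F i = F o + \sum_(i < n | (0 < i < n)%N) F i.
Proof.
rewrite -sum_axis ?(leq_trans _ n_ge3) //.
by apply: eq_bigl => i; rewrite ltn_ord.
Qed.

Definition axpos (x : V * V) : R := co (x.1 - c) o.
Definition axvel (x : V * V) : R := co x.2 o.
Definition rho k (x : V * V) : R := dotk k (x.1 - c) (x.1 - c).
Definition sig k (x : V * V) : R := dotk k (x.1 - c) x.2.
Definition tau k (x : V * V) : R := dotk k x.2 x.2.

(* [F] has at [x] the differential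
   [a dy_0 + b dw_0 + r drho_k + s dsig_k + t dtau_k]. *)
Definition rgrad k (F : V * V -> R) x (a b r s t : R) : Prop :=
  is_diff x F (fun h =>
    a * co h.1 o + b * co h.2 o + r * (2 * dotk k (x.1 - c) h.1)
    + s * (dotk k x.2 h.1 + dotk k (x.1 - c) h.2) + t * (2 * dotk k x.2 h.2)).

Lemma rgrad_eq k F x a b r s t a' b' r' s' t' :
  rgrad k F x a b r s t -> a = a' -> b = b' -> r = r' -> s = s' -> t = t' ->
  rgrad k F x a' b' r' s' t'.
Proof. by move=> ? <- <- <- <- <-. Qed.

Lemma rgrad_const k x m : rgrad k (fun=> m) x 0 0 0 0 0.
Proof.
apply: is_diff_eq (is_diff_const _ _) _.
by apply/funext => h; rewrite !mul0r !addr0.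
Qed.

Lemma rgrad_axpos k x : rgrad k axpos x 1 0 0 0 0.
Proof.
apply: is_diff_eq (is_diff_pos _ _ _ _) _.
by apply/funext => h; rewrite !mul0r !addr0 mul1r.
Qed.

Lemma rgrad_axvel k x : rgrad k axvel x 0 1 0 0 0.
Proof.
apply: is_diff_eq (is_diff_vel _ _ _) _.
by apply/funext => h; rewrite !mul0r !addr0 add0r mul1r.
Qed.

Lemma rgrad_rho k x : rgrad k (rho k) x 0 0 1 0 0.
Proof.
apply: is_diff_eq.
  apply: is_diff_sum => i.
  exact: is_diffM_pt (is_diff_pos _ _ _ _) (is_diff_pos _ _ _ _).
apply/funext => h /=; rewrite !mul0r !addr0 !add0r mul1r mulr_sumr.
by apply: eq_bigr => i _; rewrite /=; ring.
Qed.

Lemma rgrad_sig k x : rgrad k (sig k) x 0 0 0 1 0.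
Proof.
apply: is_diff_eq.
  apply: is_diff_sum => i.
  exact: is_diffM_pt (is_diff_pos _ _ _ _) (is_diff_vel _ _ _).
apply/funext => h /=; rewrite !mul0r !addr0 !add0r mul1r -big_split.
by apply: eq_bigr => i _; rewrite /=; ring.
Qed.

Lemma rgrad_tau k x : rgrad k (tau k) x 0 0 0 0 1.
Proof.
apply: is_diff_eq.
  apply: is_diff_sum => i.
  exact: is_diffM_pt (is_diff_vel _ _ _) (is_diff_vel _ _ _).
apply/funext => h /=; rewrite !mul0r !add0r mul1r mulr_sumr.
by apply: eq_bigr => i _; rewrite /=; ring.
Qed.

Lemma rgradD k F F' x a b r s t a' b' r' s' t' :
  rgrad k F x a b r s t -> rgrad k F' x a' b' r' s' t' ->
  rgrad k (fun y => F y + F' y) x (a + a') (b + b') (r + r') (s + s') (t + t').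
Proof.
move=> dF dF'; apply: is_diff_eq (is_diffD_pt dF dF') _.
by apply/funext => h; ring.
Qed.

Lemma rgradM k F F' x a b r s t a' b' r' s' t' :
  rgrad k F x a b r s t -> rgrad k F' x a' b' r' s' t' ->
  rgrad k (fun y => F y * F' y) x (F x * a' + F' x * a) (F x * b' + F' x * b)
    (F x * r' + F' x * r) (F x * s' + F' x * s) (F x * t' + F' x * t).
Proof.
move=> dF dF'; apply: is_diff_eq (is_diffM_pt dF dF') _.
by apply/funext => h; ring.
Qed.

Lemma rgradZ k F x m a b r s t : rgrad k F x a b r s t ->
  rgrad k (fun y => m * F y) x (m * a) (m * b) (m * r) (m * s) (m * t).
Proof.
by move=> dF; apply: rgrad_eq (rgradM (rgrad_const k x m) dF) _ _ _ _ _; ring.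
Qed.

Lemma rgradB k F F' x a b r s t a' b' r' s' t' :
  rgrad k F x a b r s t -> rgrad k F' x a' b' r' s' t' ->
  rgrad k (fun y => F y - F' y) x (a - a') (b - b') (r - r') (s - s') (t - t').
Proof.
move=> dF dF'; have := rgradD dF (rgradZ (-1) dF').
rewrite (_ : (fun _ => _) = fun y => F y - F' y); last first.
  by apply/funext => y; rewrite mulN1r.
by move/rgrad_eq; apply; ring.
Qed.

Lemma rgrad_sqrtV k F x a b r s t : 0 < F x -> rgrad k F x a b r s t ->
  let u := - 2^-1 * (Num.sqrt (F x))^-1 ^+ 3 in
  rgrad k (fun y => (Num.sqrt (F y))^-1) x (u * a) (u * b) (u * r) (u * s) (u * t).
Proof.
move=> F0 dF u; apply: is_diff_eq (is_diff_sqrtV F0 dF) _.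
by apply/funext => h; rewrite /u; ring.
Qed.

(** The form described by [rgrad], expanded in the full set of coordinates: [pos_part] gives the
    coefficients of the dy_i and [vel_part] those of the dw_i. *)
Definition pos_part k x (a r s : R) (i : 'I_n) : R :=
  if i == o then a else
  if (i < k)%N then 2 * r * co (x.1 - c) i + s * co x.2 i else 0.

Definition vel_part k x (b s t : R) (i : 'I_n) : R :=
  if i == o then b else
  if (i < k)%N then s * co (x.1 - c) i + 2 * t * co x.2 i else 0.

Lemma rgrad_parts k F x a b r s t : (k <= n)%N -> rgrad k F x a b r s t ->
  is_diff x F (fun h => \sum_i pos_part k x a r s i * co h.1 i
                      + \sum_i vel_part k x b s t i * co h.2 i).
Proof.
move=> kn dF; apply: is_diff_eq dF _; apply/funext => h.
have cut (A B : 'I_n -> R) a0 : \sum_i (if i == o then a0 else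
      if (i < k)%N then A i else 0) * B i
    = a0 * B o + \sum_(i < n | (0 < i < k)%N) A i * B i.
  rewrite (bigD1 o) //= ?eqxx; congr (_ + _).
  rewrite (bigID (fun i : 'I_n => (i < k)%N)) /= [X in _ + X]big1 ?addr0.
    apply: eq_big => [i|i /andP[i0 ik]]; first by rewrite ord_firstE.
    by rewrite (negPf i0) ik.
  by move=> i /andP[/negPf -> /negPf ->]; rewrite mul0r.
rewrite !cut /dotk !mulr_sumr mulrDr !mulr_sumr.
have -> : \sum_(i < n | (0 < i < k)%N)
     (2 * r * co (x.1 - c) i + s * co x.2 i) * co h.1 i
   = \sum_(i < n | (0 < i < k)%N) r * (2 * (co (x.1 - c) i * co h.1 i))
   + \sum_(i < n | (0 < i < k)%N) s * (co x.2 i * co h.1 i).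
  by rewrite -big_split; apply: eq_bigr => i _ /=; ring.
have -> : \sum_(i < n | (0 < i < k)%N)
     (s * co (x.1 - c) i + 2 * t * co x.2 i) * co h.2 i
   = \sum_(i < n | (0 < i < k)%N) s * (co (x.1 - c) i * co h.2 i)
   + \sum_(i < n | (0 < i < k)%N) t * (2 * (co x.2 i * co h.2 i)).
  by rewrite -big_split; apply: eq_bigr => i _ /=; ring.
ring.
Qed.

(** Off the axis only the indices below the smaller bound [k] contribute, since the parts of the
    first function vanish beyond it. The constants are those of the [sl_2] relations {rho, sig} = 2
    rho, {rho, tau} = 4 sig, {sig, tau} = 2 tau. *)
Lemma poisson_parts k l x a1 b1 r1 s1 t1 a2 b2 r2 s2 t2 : (k <= l)%N ->
  \sum_i (pos_part k x a1 r1 s1 i * vel_part l x b2 s2 t2 i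
        - vel_part k x b1 s1 t1 i * pos_part l x a2 r2 s2 i)
  = a1 * b2 - b1 * a2 + 2 * rho k x * (r1 * s2 - s1 * r2)
    + 4 * sig k x * (r1 * t2 - t1 * r2) + 2 * tau k x * (s1 * t2 - t1 * s2).
Proof.
move=> kl; rewrite (bigD1 o) //= /pos_part /vel_part ?eqxx -!addrA; congr (_ + (_ + _)).
rewrite (bigID (fun i : 'I_n => (i < k)%N)) /= [X in _ + X]big1 ?addr0; last first.
  by move=> i /andP[/negPf -> /negPf ->]; rewrite !mul0r subr0.
rewrite /rho /sig /tau /dotk !mulr_sumr !mulr_suml -!big_split /=.
apply: eq_big => [i|i /andP[/negPf -> ik]]; first by rewrite ord_firstE.
by rewrite ik (leq_trans ik kl); ring.
Qed.

Variables (G : 'M[R]_n).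
Hypothesis PGP : P *m G *m P^T = 1%:M.

Lemma poisson_rgrad (S : mech_system R n) k l F1 F2 x
    a1 b1 r1 s1 t1 a2 b2 r2 s2 t2 :
  metric S = G -> (k <= l <= n)%N ->
  rgrad k F1 x a1 b1 r1 s1 t1 -> rgrad l F2 x a2 b2 r2 s2 t2 ->
  poisson S F1 F2 x
  = a1 * b2 - b1 * a2 + 2 * rho k x * (r1 * s2 - s1 * r2)
    + 4 * sig k x * (r1 * t2 - t1 * r2) + 2 * tau k x * (s1 * t2 - t1 * s2).
Proof.
move=> SG /andP[kl ln] dF1 dF2; rewrite -(poisson_parts _ _ _ _ _ _ _ _ _ _ _ kl).
apply: (poisson_frame PGP SG); apply: rgrad_parts => //.
exact: leq_trans ln.
Qed.

Lemma poissonC (S : mech_system R n) F1 F2 x :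
  poisson S F1 F2 x = - poisson S F2 F1 x.
Proof.
rewrite /poisson /canonical_bracket -sumrN; apply: eq_bigr => i _.
by rewrite opprB; congr (_ - _); exact: mulrC.
Qed.

Lemma inner_axis u w : inner G u w = co u o * co w o + dotk n u w.
Proof. by rewrite (inner_co PGP) sum_axisT. Qed.

Lemma co_axis i : co (row o P) i = (i == o)%:R.
Proof. by rewrite rowE (co_frame PGP) mxE eqxx eq_sym. Qed.

Lemma dotk_axis k u : dotk k u (row o P) = 0.
Proof.
apply: big1 => i /andP[i0 _]; rewrite co_axis.
by rewrite (negPf (_ : i != o)) ?mulr0 // ord_firstE.
Qed.

Lemma inner_gt0 u : u != 0 -> 0 < inner G u u.
Proof.
move=> u0; rewrite (inner_co PGP) lt_def sumr_ge0 ?andbT; last first.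
  by move=> i _; rewrite -expr2 sqr_ge0.
apply: contra u0 => /eqP E; apply/eqP/(co_inj PGP) => i; rewrite co0.
have sq0 (j : 'I_n) : true -> 0 <= co u j * co u j by rewrite -expr2 sqr_ge0.
by apply/eqP; rewrite -sqrf_eq0 expr2 (psumr_eq0P sq0 E).
Qed.

(* Squared distance to the point at abscissa [e] of the axis. *)
Definition sqdist (e : R) (x : V * V) : R := (axpos x - e) ^+ 2 + rho n x.

Lemma inner_sqdist e (x : V * V) :
  inner G (x.1 - (c + e *: row o P)) (x.1 - (c + e *: row o P)) = sqdist e x.
Proof.
rewrite inner_axis /sqdist /rho /axpos opprD addrA; move: (x.1 - c) => u.
rewrite coB coZ co_axis eqxx !dotkDl !dotkDr !dotkNl !dotkNr !dotkZl !dotkZr.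
by rewrite (dotkC _ _ (row _ _) u) !dotk_axis mulr1; ring.
Qed.

Lemma sqdist_gt0 e x : x.1 <> c + e *: row o P -> 0 < sqdist e x.
Proof.
by move=> xe; rewrite -inner_sqdist inner_gt0 // subr_eq0; apply/eqP.
Qed.

End Reduced.

(** * The first integrals and their brackets *)

Section Integrals.
Variables (R : realType) (n : nat) (n_ge3 : (3 <= n)%N) (P : 'M[R]_n).
Variables (c : 'rV[R]_n) (d beta m1 m2 f : R).
Local Notation V := 'rV[R]_n.
Local Notation o := (ord_first n_ge3).
Local Notation co := (co P).
Local Notation dotk := (dotk P).
Local Notation y0 := (axpos n_ge3 P c).
Local Notation w0 := (axvel n_ge3 P).
Local Notation rho := (rho P c).
Local Notation sig := (sig P c).
Local Notation tau := (tau P).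
Local Notation sqdist := (sqdist n_ge3 P c).
Local Notation rgrad := (rgrad n_ge3 P c).

Definition kepler (m e : R) (x : V * V) : R := m / Num.sqrt (sqdist e x).

Definition potential (x : V * V) : R :=
  kepler m1 d x + kepler m2 (- d) x + f * (y0 x ^+ 2 + rho n x).

Definition energy (x : V * V) : R :=
  2^-1 * (w0 x ^+ 2 + tau n x) - potential x.

(* [E_sph] is the case [d = a / sqrt (1 + a ^ 2)], [beta = 1 + a ^ 2]. *)
Definition second_integral (x : V * V) : R :=
  beta * (2^-1 * (w0 x ^+ 2 + (1 - d ^+ 2) * tau n x + y0 x ^+ 2 * tau n x
                  + rho n x * w0 x ^+ 2 - 2 * y0 x * w0 x * sig n x
                  + (1 - d ^+ 2) * (rho n x * tau n x - sig n x ^+ 2))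
          - f * (y0 x ^+ 2 + (1 - d ^+ 2) * rho n x)
          - (1 - d ^+ 2 + d * y0 x) * kepler m1 d x
          - (1 - d ^+ 2 - d * y0 x) * kepler m2 (- d) x).

Definition angular k (x : V * V) : R := rho k x * tau k x - sig k x ^+ 2.

Definition integrals (i : 'I_n) : V * V -> R :=
  match val i with
  | 0 => energy
  | 1 => second_integral
  | k.+2 => angular k.+3
  end.

(** A center of zero mass belongs to the configuration space, hence the first alternative: there the
    distance may vanish. *)
Definition regular (m e : R) (x : V * V) : Prop := m = 0 \/ 0 < sqdist e x.

Definition regular_set : set (V * V) :=
  [set x | regular m1 d x /\ regular m2 (- d) x].

(** The mass over the cube of the distance, which is the common factor of the gradient of
    [kepler]. *)
Definition kepler3 (m e : R) (x : V * V) : R :=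
  m * (Num.sqrt (sqdist e x))^-1 ^+ 3.

(** Eliminates the square roots: once each [kepler] is replaced, brackets become polynomial in the
    reduced variables and in the two values of [kepler3]. *)
Lemma keplerE m e x : regular m e x ->
  kepler m e x = kepler3 m e x * sqdist e x.
Proof.
rewrite /kepler /kepler3 => -[->|D0]; first by rewrite !mul0r.
have s0 : Num.sqrt (sqdist e x) != 0 by rewrite gt_eqF ?sqrtr_gt0.
by rewrite -{3}[sqdist e x]sqr_sqrtr ?ltW //; field.
Qed.

Lemma rgrad_sqr k F x a b r s t : rgrad k F x a b r s t ->
  rgrad k (fun y => F y ^+ 2) x (2 * F x * a) (2 * F x * b) (2 * F x * r)
    (2 * F x * s) (2 * F x * t).
Proof. by move=> dF; apply: rgrad_eq (rgradM dF dF) _ _ _ _ _; ring. Qed.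

Lemma rgrad_sqdist e x :
  rgrad n (sqdist e) x (2 * (y0 x - e)) 0 1 0 0.
Proof.
have dy := rgradB (rgrad_axpos n_ge3 P c n x) (rgrad_const n_ge3 P c n x e).
by apply: rgrad_eq (rgradD (rgrad_sqr dy) (rgrad_rho _ _ _ _ _)) _ _ _ _ _; ring.
Qed.

(** For zero mass the function is identically 0, so the formula also holds at the center, where the
    root is not differentiable. *)
Lemma rgrad_kepler m e x : regular m e x ->
  rgrad n (kepler m e) x
    (- (kepler3 m e x * (y0 x - e))) 0 (- (2^-1 * kepler3 m e x)) 0 0.
Proof.
case=> [m0|D0].
  have -> : kepler m e = fun=> 0.
    by apply/funext => y; rewrite /kepler m0 mul0r.
  have k0 : kepler3 m e x = 0 by rewrite /kepler3 m0 mul0r.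
  rewrite k0 mul0r mulr0 oppr0; exact: rgrad_const.
have dk := rgradZ m (rgrad_sqrtV D0 (rgrad_sqdist e x)).
by apply: rgrad_eq dk _ _ _ _ _; rewrite /kepler3;
  move: (Num.sqrt _)^-1 => ir; field.
Qed.

Lemma rgrad_potential x : regular_set x ->
  rgrad n potential x
    (2 * f * y0 x - kepler3 m1 d x * (y0 x - d) - kepler3 m2 (- d) x * (y0 x + d))
    0 (f - 2^-1 * kepler3 m1 d x - 2^-1 * kepler3 m2 (- d) x) 0 0.
Proof.
move=> [reg1 reg2].
have dU := rgradD (rgradD (rgrad_kepler reg1) (rgrad_kepler reg2))
  (rgradZ f (rgradD (rgrad_sqr (rgrad_axpos n_ge3 P c n x)) (rgrad_rho _ _ _ _ _))).
by apply: rgrad_eq dU _ _ _ _ _; ring.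
Qed.

Lemma rgrad_energy x : regular_set x ->
  rgrad n energy x
    (- (2 * f * y0 x - kepler3 m1 d x * (y0 x - d) - kepler3 m2 (- d) x * (y0 x + d)))
    (w0 x) (- (f - 2^-1 * kepler3 m1 d x - 2^-1 * kepler3 m2 (- d) x)) 0 2^-1.
Proof.
move=> reg.
have dE := rgradB (rgradZ 2^-1 (rgradD (rgrad_sqr (rgrad_axvel n_ge3 P c n x))
  (rgrad_tau n_ge3 P c n x))) (rgrad_potential reg).
by apply: rgrad_eq dE _ _ _ _ _; field.
Qed.

Lemma rgrad_second x : regular_set x ->
  let L1 := 1 - d ^+ 2 + d * y0 x in let L2 := 1 - d ^+ 2 - d * y0 x in
  let K1 := kepler3 m1 d x in let K2 := kepler3 m2 (- d) x in
  rgrad n second_integral x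
    (beta * (y0 x * tau n x - w0 x * sig n x - 2 * f * y0 x
       + L1 * K1 * (y0 x - d) + L2 * K2 * (y0 x + d)
       - d * kepler m1 d x + d * kepler m2 (- d) x))
    (beta * (w0 x + rho n x * w0 x - y0 x * sig n x))
    (beta * (2^-1 * w0 x ^+ 2 + 2^-1 * (1 - d ^+ 2) * tau n x - f * (1 - d ^+ 2)
       + 2^-1 * L1 * K1 + 2^-1 * L2 * K2))
    (beta * (- (y0 x * w0 x) - (1 - d ^+ 2) * sig n x))
    (beta * (2^-1 * (1 - d ^+ 2) + 2^-1 * y0 x ^+ 2
       + 2^-1 * (1 - d ^+ 2) * rho n x)).
Proof.
move=> [reg1 reg2] L1 L2 K1 K2.
have dy := rgrad_axpos n_ge3 P c n x; have dw := rgrad_axvel n_ge3 P c n x.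
have dr := rgrad_rho n_ge3 P c n x; have ds := rgrad_sig n_ge3 P c n x.
have dt := rgrad_tau n_ge3 P c n x.
have d1 := rgrad_kepler reg1; have d2 := rgrad_kepler reg2.
have dc m := rgrad_const n_ge3 P c n x m.
have dT := rgradD (rgradB (rgradD (rgradD (rgradD (rgrad_sqr dw)
    (rgradZ (1 - d ^+ 2) dt)) (rgradM (rgrad_sqr dy) dt)) (rgradM dr (rgrad_sqr dw)))
    (rgradM (rgradM (rgradZ 2 dy) dw) ds))
    (rgradZ (1 - d ^+ 2) (rgradB (rgradM dr dt) (rgrad_sqr ds))).
have dU := rgradB (rgradB (rgradB (rgradZ 2^-1 dT)
    (rgradZ f (rgradD (rgrad_sqr dy) (rgradZ (1 - d ^+ 2) dr))))
    (rgradM (rgradD (dc (1 - d ^+ 2)) (rgradZ d dy)) d1))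
    (rgradM (rgradB (dc (1 - d ^+ 2)) (rgradZ d dy)) d2).
by apply: rgrad_eq (rgradZ beta dU) _ _ _ _ _; rewrite /L1 /L2 /K1 /K2; field.
Qed.

Lemma rgrad_angular k x :
  rgrad k (angular k) x 0 0 (tau k x) (- (2 * sig k x)) (rho k x).
Proof.
have dA := rgradB (rgradM (rgrad_rho n_ge3 P c k x) (rgrad_tau n_ge3 P c k x))
  (rgrad_sqr (rgrad_sig n_ge3 P c k x)).
by apply: rgrad_eq dA _ _ _ _ _; ring.
Qed.

Variables (G : 'M[R]_n) (S : mech_system R n).
Hypothesis PGP : P *m G *m P^T = 1%:M.
Hypothesis metricS : metric S = G.

(** With the square roots eliminated by [keplerE], the bracket is a polynomial that vanishes
    identically, whatever [d] and [beta] are. *)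
Lemma poisson_energy_second x : regular_set x ->
  poisson S energy second_integral x = 0.
Proof.
move=> reg; have [reg1 reg2] := reg.
have nn : (n <= n <= n)%N by rewrite leqnn.
rewrite (poisson_rgrad PGP metricS nn (rgrad_energy reg) (rgrad_second reg)).
by rewrite (keplerE reg1) (keplerE reg2) /sqdist; field.
Qed.

(** The Casimir property: the coefficients [tau k], [- (2 * sig k)], [rho k] cancel the three [sl_2]
    terms for every [F], and there is no axial term. *)
Lemma poisson_angular k l F x a b r s t : (k <= l <= n)%N ->
  rgrad l F x a b r s t -> poisson S (angular k) F x = 0.
Proof.
move=> kl dF; rewrite (poisson_rgrad PGP metricS kl (rgrad_angular k x) dF).
ring.
Qed.

Lemma poissonxx F x : poisson S F F x = 0.
Proof.
rewrite /poisson /canonical_bracket; apply: big1 => i _.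
by rewrite mulrC subrr.
Qed.

Lemma involution i j x : regular_set x ->
  poisson S (integrals i) (integrals j) x = 0.
Proof.
move=> reg; have ltk k (i' : 'I_n) : val i' = k.+2 -> (k.+3 <= n)%N.
  by move=> <-; exact: ltn_ord.
have low (j' : 'I_n) : (val j' < 2)%N ->
    exists a b r s t, rgrad n (integrals j') x a b r s t.
  rewrite /integrals; case: (val j') => [|[|k]] // _; do 5! eexists.
    exact: rgrad_energy.
  exact: rgrad_second.
have low_ang (i' j' : 'I_n) : (1 < val i')%N -> (val j' < 2)%N ->
    poisson S (integrals i') (integrals j') x = 0.
  move=> i2 /low [a [b [r [s [t dj]]]]].
  have := ltk^~ i'; rewrite {1}/integrals.
  case: (val i') i2 => [|[|k]] // _ /(_ _ erefl) kn.
  by apply: poisson_angular dj; rewrite kn leqnn.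
case: (ltnP 1 (val i)) => i2; case: (ltnP 1 (val j)) => j2.
- have := ltk^~ i; have := ltk^~ j; rewrite /integrals.
  case: (val i) i2 => [|[|k]] // _; case: (val j) j2 => [|[|l]] // _.
  move=> /(_ _ erefl) ln /(_ _ erefl) kn.
  (* [poisson_angular] wants the smaller index first; antisymmetry of the bracket gives the other
     order. *)
  case: (leqP k l) => kl; [|rewrite poissonC].
    by apply: poisson_angular (rgrad_angular _ _); rewrite ln andbT.
  rewrite (poisson_angular _ (rgrad_angular _ _)) ?oppr0 //.
  by rewrite kn andbT !ltnS ltnW.
- exact: low_ang.
- by rewrite poissonC low_ang ?oppr0.
rewrite /integrals; case: (val i) i2 => [|[|k]] // _;
  case: (val j) j2 => [|[|l]] // _.
- exact: poissonxx.
- exact: poisson_energy_second.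
- by rewrite poissonC poisson_energy_second ?oppr0.
- exact: poissonxx.
Qed.

End Integrals.

(** * Conservation and smoothness *)

Lemma is_diff_curve (R : realType) (U : normedModType R) (g : R -> U) (u : R) :
  derivable g u 1 -> is_diff u g (fun h => h *: derive1 g u).
Proof.
by move=> /derivable1_diffP dg; split; [exact: dg|exact: diff1E].
Qed.

Section SmoothFrame.
Variables (R : realType) (n : nat) (P : 'M[R]_n) (c : 'rV[R]_n).
Local Notation V := 'rV[R]_n.
Variable (D : set (V * V)).
Hypothesis oD : open D.

Lemma smooth_pos i : smooth_on D (fun x => co P (x.1 - c) i).
Proof. by apply: smooth_affine oD _ => x; exact: is_diff_pos. Qed.

Lemma smooth_vel i : smooth_on D (fun x => co P x.2 i).
Proof. by apply: smooth_affine oD _ => x; exact: is_diff_vel. Qed.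

Lemma smooth_rho k : smooth_on D (rho P c k).
Proof. by apply: smooth_sum oD _ => i; apply: (smoothM oD); exact: smooth_pos. Qed.

Lemma smooth_sig k : smooth_on D (sig P c k).
Proof.
apply: smooth_sum oD _ => i.
by apply: (smoothM oD); [exact: smooth_pos|exact: smooth_vel].
Qed.

Lemma smooth_tau k : smooth_on D (tau P k).
Proof. by apply: smooth_sum oD _ => i; apply: (smoothM oD); exact: smooth_vel. Qed.

End SmoothFrame.

Lemma kepler_sing0 (R : realType) (n : nat) (Z : 'rV[R]_n) :
  kepler_sing 0 Z = set0.
Proof. by apply/seteqP; split=> q // -[]; rewrite eqxx. Qed.

Section LagrangeSystem.
Variables (R : realType) (n : nat) (n_ge3 : (3 <= n)%N) (P : 'M[R]_n).
Variables (c : 'rV[R]_n) (d beta m1 m2 f : R) (G : 'M[R]_n).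
Local Notation V := 'rV[R]_n.
Local Notation o := (ord_first n_ge3).
Local Notation co := (co P).
Local Notation dotk := (dotk P).
Hypothesis PGP : P *m G *m P^T = 1%:M.

Let Z1 := c + d *: row o P.
Let Z2 := c + (- d) *: row o P.
Let S := lagrange_system G m1 m2 f Z1 Z2 c.
Local Notation potential := (potential n_ge3 P c d m1 m2 f).
Local Notation energy := (energy n_ge3 P c d m1 m2 f).
Local Notation integrals := (integrals n_ge3 P c d beta m1 m2 f).
Local Notation regular_set := (regular_set n_ge3 P c d m1 m2).

Lemma TM_regular x : TM S x -> regular_set x.
Proof.
rewrite /TM /S /= => /not_orP [h1 h2]; split.
  have [->|m10] := eqVneq m1 0; [by left|right].
  by apply: (sqdist_gt0 PGP) => xZ; apply: h1.
have [->|m20] := eqVneq m2 0; [by left|right].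
by apply: (sqdist_gt0 PGP) => xZ; apply: h2.
Qed.

Lemma closed_kepler_sing m (Z : V) : closed (kepler_sing m Z).
Proof.
have [->|m0] := eqVneq m 0; first by rewrite kepler_sing0; exact: closed0.
rewrite (_ : kepler_sing m Z = [set Z]).
  exact/accessible_closed_set1/hausdorff_accessible/norm_hausdorff.
by apply/seteqP; split=> [q [] //|q ->].
Qed.

Lemma open_TM : open (TM S).
Proof.
rewrite (_ : TM S = fst @^-1` (config S)) //.
apply: open_comp => [x _|]; first exact: cvg_fst.
by apply: closed_openC; apply: closedU; exact: closed_kepler_sing.
Qed.

Lemma force_potential q v : force S q = potential (q, v).
Proof.
rewrite /S /= /Defs.gnorm /potential /kepler -!(inner_sqdist _ _ PGP) /=.
rewrite sqr_sqrtr.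
  by congr (_ + f * _); rewrite (inner_axis n_ge3 PGP) -expr2.
by rewrite (inner_co PGP) sumr_ge0 // => i _; rewrite -expr2 sqr_ge0.
Qed.

Lemma co_row i j : co (row i P) j = (j == i)%:R.
Proof. by rewrite rowE (co_frame PGP) mxE eqxx. Qed.

Lemma dotk_row k u i : dotk k u (row i P) = if (0 < i < k)%N then co u i else 0.
Proof.
rewrite /dotk; case: ifPn => ik.
  rewrite (bigD1 i) //= co_row eqxx mulr1 big1 ?addr0 // => j /andP[_ /negPf ji].
  by rewrite co_row ji mulr0.
apply: big1 => j jk; rewrite co_row; case: eqP => [ji|_]; last by rewrite mulr0.
by move: ik; rewrite -ji jk.
Qed.

(** Newton's equation in Hamiltonian form: the acceleration is minus the position part of the
    differential of [energy]. *)
Lemma co_grad q v : config S q -> exists a r,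
  rgrad n_ge3 P c n energy (q, v) a (axvel n_ge3 P (q, v)) r 0 2^-1 /\
  forall i, co (grad G (force S) q) i = - pos_part n_ge3 P c n (q, v) a r 0 i.
Proof.
move=> cq; have reg w : regular_set (q, w) by exact: TM_regular.
do 2! eexists; split=> [|i]; first exact: (rgrad_energy f (reg v)).
(* [potential] lives on phase space but ignores the velocity, so it is restricted to zero velocity
   in order to be differentiated in the position alone. *)
have fE : force S = potential \o (fun p => (p, 0)).
  by apply/funext => p; exact: force_potential.
have dp : is_diff q (fun p : V => (p, 0 : V)) (fun h => (h, 0)).
  exact: (is_diff_pair (is_diff_id q) (is_diff_cst (0 : V) q)).
have dP := rgrad_potential f (reg 0); rewrite /rgrad in dP.
have := @is_diff_comp R _ _ _ _ _ _ _ q dp dP; rewrite -fE => dU.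
rewrite /grad /co (invmx_metric PGP) mulmxA mulmxK ?(frame_unit PGP) // mxE.
(* The inverse metric is [P^T *m P], and taking coordinates cancels [P]: what is left is the
   derivative along the [i]-th frame vector. *)
transitivity ('d (force S) q (row i P)).
  rewrite [row i P]row_sum_delta linear_sum; apply: eq_bigr => k _.
  by rewrite linearZ /= !mxE mulrC.
have [_ ->] := dU.
rewrite /= co_row dotk_row ltn_ord andbT /pos_part eq_sym.
case: eqP => [->|/eqP io]; first by rewrite ltnn !(mul0r, mulr0, addr0) mulr1; ring.
by rewrite -(ord_firstE n_ge3) io ltn_ord !(mul0r, mulr0, addr0); ring.
Qed.

(** The derivative of [F] along a motion is minus the bracket of [energy] with [F]: the velocity is
    the velocity part of the differential of [energy], and [co_grad] gives the acceleration. *)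
Lemma conserved_first_integral (F : V * V -> R) :
  (forall x, TM S x -> poisson S energy F x = 0) ->
  (forall x, TM S x -> exists A B, is_diff x F
      (fun h => \sum_i A i * co h.1 i + \sum_i B i * co h.2 i)) ->
  first_integral S F.
Proof.
move=> EF dF s t q motion.
pose phi u := F (q u, derive1 q u).
have dphi u : s < u < t -> is_derive u 1 phi 0.
  move=> su; have [cq dq dq' q''] := motion u su.
  have [A [B dFx]] := dF (q u, derive1 q u) cq.
  have [a [r [dE q2]]] := co_grad (derive1 q u) cq.
  have dc : is_diff u (fun u => (q u, derive1 q u))
      (fun h => (h *: derive1 q u, h *: derive1 (derive1 q) u)).
    exact: is_diff_pair (is_diff_curve dq) (is_diff_curve dq').
  have [dphi1 dphi2] := is_diff_comp dc dFx.
  split; first by apply/derivable1_diffP; exact: dphi1.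
  rewrite deriveE // dphi2 /= !scale1r q''.
  have := EF (q u, derive1 q u) cq.
  rewrite (poisson_frame PGP _ (rgrad_parts (leqnn n) dE) dFx) //.
  move/(congr1 -%R); rewrite oppr0; apply: etrans.
  rewrite -big_split -sumrN; apply: eq_bigr => i _ /=.
  rewrite (q2 i) /vel_part ltn_ord /axvel.
  by case: eqP => [->|_] /=; field.
move=> u u'; wlog uu' : u u' / u <= u' => [H|] su su'.
  case: (leP u u') => [uu'|/ltW uu']; first exact: H.
  by rewrite (H _ _ uu').
(* Mean value theorem, the derivative of [phi] being 0 on the whole segment. *)
have [z _] : exists2 z, z \in `[u, u'] & phi u' - phi u = 0 * (u' - u).
  have sub z : z \in `[u, u'] -> s < z < t.
    rewrite in_itv /= => /andP[uz zu']; case/andP: su => su _.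
    by case/andP: su' => _ u't; rewrite (lt_le_trans su uz) (le_lt_trans zu' u't).
  apply: MVT_segment => //.
    by move=> z zi; apply/dphi/sub; apply: subset_itv_oo_cc.
  apply: derivable_within_continuous => z zi.
  by have [] := dphi z (sub _ zi).
by rewrite mul0r => /subr0_eq/esym.
Qed.

Lemma integrals_first_integral i : first_integral S (integrals i).
Proof.
have n0 : (0 < n)%N by exact: leq_trans n_ge3.
apply: conserved_first_integral => x /TM_regular reg.
  (* [energy] is the integral of index 0, so conservation is a case of involution. *)
  have := involution beta f (S := S) PGP erefl (Ordinal n0) i reg.
  by rewrite /integrals /=.
have kn k : val i = k.+2 -> (k.+3 <= n)%N by move=> <-; exact: ltn_ord.
rewrite /integrals; case: (val i) kn => [|[|k]] kn; do 2! eexists.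
- exact: rgrad_parts (leqnn n) (rgrad_energy f reg).
- exact: rgrad_parts (leqnn n) (rgrad_second beta f reg).
- exact: rgrad_parts (kn _ erefl) (rgrad_angular _ _ _ _ _).
Qed.

Let sm F F' := @smoothM R _ (TM S) F F' open_TM.
Let sb F F' := @smoothB R _ (TM S) F F' open_TM.
Let sd F F' := @smoothD R _ (TM S) F F' open_TM.
Let sc a := @smooth_const R _ (TM S) a open_TM.

(** For [m = 0] the function is constant; otherwise regularity makes the radicand positive on the
    whole phase space. *)
Lemma smooth_kepler m e :
  (forall x, TM S x -> regular n_ge3 P c m e x) ->
  smooth_on (TM S) (kepler n_ge3 P c m e).
Proof.
move=> reg; have [m0|m0] := eqVneq m 0.
  rewrite (_ : kepler _ _ _ _ _ = fun=> 0); first exact: sc.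
  by apply/funext => x; rewrite /kepler m0 mul0r.
apply: sm (sc m) _; apply: smooth_sqrtV open_TM _ _ => [x Tx|].
  by have [/eqP|//] := reg x Tx; rewrite (negPf m0).
apply: sd; last exact: smooth_rho open_TM n.
by apply: sm; apply: sb (sc _); exact: smooth_pos open_TM o.
Qed.

Lemma integrals_smooth i : smooth_on (TM S) (integrals i).
Proof.
have k1 : smooth_on (TM S) (kepler n_ge3 P c m1 d).
  by apply: smooth_kepler => x /TM_regular[].
have k2 : smooth_on (TM S) (kepler n_ge3 P c m2 (- d)).
  by apply: smooth_kepler => x /TM_regular[].
have sy := smooth_pos P c open_TM o; have sw := smooth_vel P open_TM o.
have sr := smooth_rho P c open_TM; have ss := smooth_sig P c open_TM.
have st := smooth_tau P open_TM.
have sy2 := sm sy sy; have sw2 := sm sw sw.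
rewrite /integrals; case: (val i) => [|[|k]].
- exact: (sb (sm (sc _) (sd sw2 (st _)))
    (sd (sd k1 k2) (sm (sc _) (sd sy2 (sr _))))).
- have sT := sd (sb (sd (sd (sd sw2 (sm (sc (1 - d ^+ 2)) (st n)))
    (sm sy2 (st n))) (sm (sr n) sw2)) (sm (sm (sm (sc 2) sy) sw) (ss n)))
    (sm (sc (1 - d ^+ 2)) (sb (sm (sr n) (st n)) (sm (ss n) (ss n)))).
  exact: (sm (sc _) (sb (sb (sb (sm (sc _) sT)
    (sm (sc _) (sd sy2 (sm (sc _) (sr _)))))
    (sm (sd (sc _) (sm (sc _) sy)) k1)) (sm (sb (sc _) (sm (sc _) sy)) k2))).
- exact: (sb (sm (sr _) (st _)) (sm (ss _) (ss _))).
Qed.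

End LagrangeSystem.

(** * Functional independence *)

(** The points e/2, e/3, e/4, ... are distinct and lie between 0 and [e]; [size p] of them are too
    many to be all roots of [p]. *)
Lemma poly_nonroot_small (R : realFieldType) (p : {poly R}) (e : R) :
  p != 0 -> 0 < e -> exists2 t, 0 < t < e & p.[t] != 0.
Proof.
move=> p0 e0; pose z (k : nat) := e / (k.+2)%:R.
have zi : injective z.
  move=> k l /(mulfI (lt0r_neq0 e0)) /invr_inj /eqP.
  by rewrite eqr_nat => /eqP [].
have zlt k : 0 < z k < e.
  by rewrite divr_gt0 //= ltr_pdivrMr ?ltr0n // ltr_pMr // ltr1n.
suff : has (fun k => ~~ root p (z k)) (iota 0 (size p)).
  by move=> /hasP[k _ pk]; exists (z k).
apply/negP => /negP; rewrite -all_predC => /allP H.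
have : (size [seq z k | k <- iota 0 (size p)] < size p)%N.
  apply: max_poly_roots => //; last by rewrite map_inj_uniq ?iota_uniq.
  by apply/allP => _ /mapP[k /H /negPn pk ->].
by rewrite size_map size_iota ltnn.
Qed.

(** * Density of the nonzero set of a function that is polynomial along lines *)

Section LinePolynomial.
Variables (R : realType) (W : normedModType R).
Implicit Types F : W -> R.

(** A substitute for polynomials in several variables: restrictions to lines are all that the
    density argument uses. *)
Definition line_poly F : Prop :=
  forall x y, exists p : {poly R}, forall t, F (x + t *: y) = p.[t].

Lemma line_poly_const a : line_poly (fun=> a).
Proof. by move=> x y; exists a%:P => t; rewrite hornerC. Qed.

Lemma line_polyD F F' : line_poly F -> line_poly F' ->
  line_poly (fun x => F x + F' x).
Proof.
move=> pF pF' x y; have [p pE] := pF x y; have [p' pE'] := pF' x y.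
by exists (p + p') => t; rewrite hornerD pE pE'.
Qed.

Lemma line_polyM F F' : line_poly F -> line_poly F' ->
  line_poly (fun x => F x * F' x).
Proof.
move=> pF pF' x y; have [p pE] := pF x y; have [p' pE'] := pF' x y.
by exists (p * p') => t; rewrite hornerM pE pE'.
Qed.

Lemma line_polyB F F' : line_poly F -> line_poly F' ->
  line_poly (fun x => F x - F' x).
Proof.
move=> pF pF' x y; have [p pE] := pF x y; have [p' pE'] := pF' x y.
by exists (p - p') => t; rewrite hornerD hornerN pE pE'.
Qed.

Lemma line_poly_sum (I : Type) (r : seq I) (q : pred I) (F : I -> W -> R) :
  (forall i, line_poly (F i)) -> line_poly (fun x => \sum_(i <- r | q i) F i x).
Proof.
move=> pF x y; elim: r => [|i r [p pE]].
  by exists 0 => t; rewrite big_nil horner0.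
have [p' pE'] := pF i x y; exists ((if q i then p' else 0) + p) => t.
rewrite big_cons pE hornerD.
by case: (q i); rewrite ?pE' // horner0 add0r.
Qed.

Lemma line_poly_prod (I : Type) (r : seq I) (q : pred I) (F : I -> W -> R) :
  (forall i, line_poly (F i)) -> line_poly (fun x => \prod_(i <- r | q i) F i x).
Proof.
move=> pF x y; elim: r => [|i r [p pE]].
  by exists 1 => t; rewrite big_nil hornerC.
have [p' pE'] := pF i x y; exists ((if q i then p' else 1) * p) => t.
rewrite big_cons pE hornerM.
by case: (q i); rewrite ?pE' // hornerC mul1r.
Qed.

(** On the line from [x] to [x0] the function is a polynomial in [t] that is nonzero at [t = 1],
    hence nonzero at arbitrarily small positive [t]. *)
Lemma line_poly_dense F (D : set W) x0 : line_poly F -> F x0 != 0 -> open D ->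
  D `<=` closure (D `&` [set x | F x != 0]).
Proof.
move=> pF F0 oD x Dx B Bx; have [p pE] := pF x (x0 - x).
have p0 : p != 0.
  apply: contra F0 => /eqP p0; have := pE 1.
  by rewrite scale1r addrC subrK p0 horner0 => ->.
have cl : (fun t : R => x + t *: (x0 - x)) @ (0 : R) --> x.
  rewrite -[X in _ --> X]addr0 -(scale0r (x0 - x)).
  apply: cvgD; first exact: cvg_cst.
  exact: scalel_continuous.
have DB : nbhs x (D `&` B) by apply: filterI => //; exact: open_nbhs_nbhs.
have /nbhs_ballP [e /= e0 he] := cl _ DB.
have [t /andP[t0 te] pt] := poly_nonroot_small p0 e0.
have [|Dt Bt] := he t.
  by rewrite -ball_normE /= sub0r normrN gtr0_norm.
by exists (x + t *: (x0 - x)); split=> //; split=> //=; rewrite pE.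
Qed.

End LinePolynomial.

(** * Independence of the differentials of the first integrals *)

Section Independence.
Variables (R : realType) (n : nat) (n_ge3 : (3 <= n)%N) (P : 'M[R]_n).
Variables (c : 'rV[R]_n) (d beta m1 m2 f : R) (G : 'M[R]_n).
Local Notation V := 'rV[R]_n.
Local Notation o := (ord_first n_ge3).
Local Notation co := (co P).
Local Notation dotk := (dotk P).
Hypothesis PGP : P *m G *m P^T = 1%:M.
Hypothesis beta0 : beta != 0.
Local Notation y0 := (axpos n_ge3 P c).
Local Notation w0 := (axvel n_ge3 P).
Local Notation rho := (rho P c).
Local Notation sig := (sig P c).
Local Notation integrals := (integrals n_ge3 P c d beta m1 m2 f).
Local Notation regular_set := (regular_set n_ge3 P c d m1 m2).

(* The minor of the velocity differentials of [energy] and [second_integral]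
   (up to the factor [beta]) on the axial direction and on the off-axis part of
   the position, a direction on which all [angular k] have zero derivative. *)
Definition axial_minor (x : V * V) : R :=
  y0 x * sig n x ^+ 2 + (y0 x ^+ 2 - d ^+ 2 - rho n x) * w0 x * sig n x
  - y0 x * rho n x * w0 x ^+ 2.

(* Half the derivative of [angular i.+1] in the [i]-th velocity direction, on
   which the [angular k] with [k <= i] do not depend: the system is
   triangular. *)
Definition angular_minor (i : 'I_n) (x : V * V) : R :=
  rho i.+1 x * co x.2 i - sig i.+1 x * co (x.1 - c) i.

Definition minors (x : V * V) : R :=
  axial_minor x * \prod_(i < n | (1 < i)%N) angular_minor i x.

Lemma rgrad_vel k F x a b r s t w : rgrad n_ge3 P c k F x a b r s t ->
  'd F x (0, w) = b * co w o + s * dotk k (x.1 - c) w + t * (2 * dotk k x.2 w).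
Proof.
have d0 u : dotk k 0 u = 0 by apply: big1 => i _; rewrite co0 mul0r.
rewrite /rgrad => -[_ ->]; rewrite /= co0 !(dotkC _ _ _ 0) !d0.
by rewrite !mulr0 !add0r addr0.
Qed.

Lemma integrals_angular (i : 'I_n) : (1 < i)%N -> integrals i = angular P c i.+1.
Proof. by rewrite /integrals /=; case: i => -[|[|k]]. Qed.

(** A relation is tested on velocity directions only. Two of them, killed by every [angular k], give
    a 2 by 2 system for the first two coefficients; the frame vectors then give a triangular system
    for the others. *)
Lemma minors_lin_indep x : regular_set x -> minors x != 0 ->
  lin_indep_differentials integrals x.
Proof.
move=> reg; rewrite mulf_eq0 negb_or => /andP[D1 /prodf_neq0 Di] cf H.
have n1 : (1 < n)%N by exact: leq_trans n_ge3.
pose o1 : 'I_n := Ordinal n1.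
have dE w := rgrad_vel w (rgrad_energy f reg).
have dJ w := rgrad_vel w (rgrad_second beta f reg).
have dC k w := rgrad_vel w (rgrad_angular n_ge3 P c k x).
have split w : cf o * 'd (energy n_ge3 P c d m1 m2 f) x (0, w)
    + cf o1 * 'd (second_integral n_ge3 P c d beta m1 m2 f) x (0, w)
    + \sum_(i < n | (1 < i)%N) cf i * 'd (angular P c i.+1) x (0, w) = 0.
  have spl (D : 'I_n -> R) :
      \sum_i D i = D o + D o1 + \sum_(i < n | (1 < i)%N) D i.
    rewrite (bigD1 o) // (bigD1 o1) //= addrA; congr (_ + _); apply: eq_bigl => i.
    by rewrite -!val_eqE /=; case: (val i) => [|[|k]].
  rewrite -[RHS](H (0, w)) [RHS]spl; congr (_ + _).
  by apply: eq_bigr => i i1; rewrite integrals_angular.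
have [co0 co1] : cf o = 0 /\ cf o1 = 0.
  have e1 := split (row o P).
  rewrite big1 in e1; last first.
    move=> i _; rewrite dC !(dotk_axis n_ge3 PGP) mul0r !mulr0 !addr0.
    by rewrite mulr0.
  rewrite dE dJ !(dotk_axis n_ge3 PGP) (co_axis n_ge3 PGP) eqxx in e1.
  rewrite !mulr0 !addr0 !mulr1 in e1.
  (* On this off-axis part of the position, the derivative of [angular k] is -2 sig rho + 2 rho sig
     = 0. *)
  pose u := x.1 - c - co (x.1 - c) o *: row o P.
  have e2 := split u.
  have du k v : dotk k v u = dotk k v (x.1 - c).
    rewrite /u (dotkDr _ _ _ (x.1 - c)) dotkNr dotkZr.
    by rewrite (dotk_axis n_ge3 PGP) mulr0 subr0.
  have cu : co u o = 0 by rewrite /u coD coN coZ (co_axis n_ge3 PGP) eqxx mulr1 subrr.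
  rewrite big1 in e2; last first.
    move=> i _; rewrite dC !du (dotkC _ _ x.2) -/(rho i.+1 x) -/(sig i.+1 x).
    by ring.
  rewrite dE dJ !du cu (dotkC _ _ x.2) -/(rho n x) -/(sig n x) in e2.
  have c1 : cf o1 * beta * axial_minor x = 0.
    (* Cramer's rule: [w0] times the second equation minus [sig n] times the first eliminates
       [cf o]. *)
    have lin (A B w s X : R) : A = 0 -> B = 0 -> X = w * A - s * B -> X = 0.
      by move=> -> -> ->; ring.
    by apply: (lin _ _ (w0 x) (sig n x) _ e2 e1); rewrite /axial_minor; field.
  have {}c1 : cf o1 = 0.
    move/eqP: c1; rewrite !mulf_eq0 (negPf beta0) (negPf D1) !orbF.
    by move/eqP.
  (* What remains is [cf o * w0 x = 0] and [cf o * sig n x = 0]; the two cofactors cannot both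
     vanish, as [axial_minor] would vanish with them. *)
  split=> //; move: e1 e2; rewrite c1 !(mul0r, mulr0, add0r, addr0).
  move/eqP; rewrite mulf_eq0 => /orP[/eqP //|/eqP w00] /eqP.
  rewrite (mulrA 2^-1) mulVf ?pnatr_eq0 // mul1r mulf_eq0 => /orP[/eqP //|/eqP s00].
  by case/negP: D1; rewrite /axial_minor w00 s00; apply/eqP; ring.
(* Descending induction on [i], with [N] bounding [n - i]. On the [i]-th frame vector, larger
   indices already have zero coefficient and smaller ones have zero derivative. *)
have hi N (i : 'I_n) : (1 < i)%N -> (n - i <= N)%N -> cf i = 0.
  elim: N i => [|N IH] i i1 iN; first by move: iN; rewrite leqn0 subn_eq0 leqNgt ltn_ord.
  have := split (row i P); rewrite co0 co1 !mul0r !add0r (bigD1 i) //= big1 ?addr0.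
    rewrite dC !(dotk_row PGP) ltnSn (ltnW i1) mul0r add0r /= => E.
    have : cf i * (2 * angular_minor i x) = 0.
      rewrite -[RHS]E /angular_minor -/(rho i.+1 x); ring.
    move/eqP; rewrite !mulf_eq0 (negPf (Di i i1)) pnatr_eq0 /= orbF.
    by move/eqP.
  move=> j /andP[j1 ji]; case: (ltngtP i j) => ij.
  - rewrite IH ?mul0r // -ltnS (leq_trans _ iN) //.
    by rewrite ltn_sub2l.
  - rewrite dC !(dotk_row PGP) (co_row PGP) ltnS (leqNgt i) ij andbF.
    rewrite (_ : _ == _ = false) ?(mul0r, mulr0, addr0) //.
    by rewrite -val_eqE /= ltn_eqF // ltnW.
  - by move/eqP: ji; case; apply: val_inj.
move=> i; case: (ltnP 1 i) => i1; first exact: hi (leqnn _).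
move: i1; case: i => -[|[|k]] // lt _.
  by rewrite -[RHS]co0; congr cf; apply: val_inj.
by rewrite -[RHS]co1; congr cf; apply: val_inj.
Qed.

Lemma line_poly_pos i : line_poly (fun x : V * V => co (x.1 - c) i).
Proof.
move=> x y; exists ((co (x.1 - c) i)%:P + (co y.1 i)%:P * 'X) => t.
by rewrite !hornerE /= !coB !coD coZ; ring.
Qed.

Lemma line_poly_vel i : line_poly (fun x : V * V => co x.2 i).
Proof.
move=> x y; exists ((co x.2 i)%:P + (co y.2 i)%:P * 'X) => t.
by rewrite !hornerE /= !coD coZ; ring.
Qed.

Lemma line_poly_minors : line_poly minors.
Proof.
pose pm (F F' : V * V -> R) := @line_polyM R _ F F'.
pose pd (F F' : V * V -> R) := @line_polyD R _ F F'.
pose pb (F F' : V * V -> R) := @line_polyB R _ F F'.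
have py := line_poly_pos; have pw := line_poly_vel.
have pr k : line_poly (rho k).
  by apply: line_poly_sum => i; exact: (pm).
have ps k : line_poly (sig k).
  by apply: line_poly_sum => i; exact: (pm).
apply: (pm); last first.
  by apply: line_poly_prod => i; apply: (pb); exact: (pm).
apply: (pb); last exact: (pm _ _ (pm _ _ (py o) (pr n)) (pm _ _ (pw o) (pw o))).
apply: (pd); first exact: (pm _ _ (py o) (pm _ _ (ps n) (ps n))).
apply: (pm); last exact: ps.
apply: (pm); last exact: pw.
exact: (pb _ _ (pb _ _ (pm _ _ (py o) (py o)) (line_poly_const _)) (pr n)).
Qed.

Lemma smooth_minors : smooth_on setT minors.
Proof.
have oT : open [set: V * V] by exact: openT.
pose sm F F' := @smoothM R _ _ F F' oT; pose sd F F' := @smoothD R _ _ F F' oT.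
pose sb F F' := @smoothB R _ _ F F' oT.
have sy := smooth_pos P c oT; have sw := smooth_vel P oT.
have sr := smooth_rho P c oT; have ss := smooth_sig P c oT.
apply: (sm); last first.
  by apply: (smooth_prod _ _ oT) => i; apply: (sb); exact: (sm).
apply: (sb); last exact: (sm _ _ (sm _ _ (sy o) (sr n)) (sm _ _ (sw o) (sw o))).
apply: (sd); first exact: (sm _ _ (sy o) (sm _ _ (ss n) (ss n))).
apply: (sm); last exact: ss.
apply: (sm); last exact: sw.
exact: (sb _ _ (sb _ _ (sm _ _ (sy o) (sy o)) (smooth_const _ oT)) (sr n)).
Qed.

Lemma minors_witness : exists x, minors x != 0.
Proof.
have n1 : (1 < n)%N by exact: leq_trans n_ge3.
pose o1 : 'I_n := Ordinal n1.
(* The position has coordinates 1 at the indices 0 and 1 only, the velocity has 1 at all off-axis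
   indices and 0 on the axis. Then [rho k] and [sig k] equal 1 for [1 < k], and every factor of
   [minors] equals 1. *)
pose x : V * V := (c + (\row_i (i <= 1)%:R) *m P, (\row_i (i != o)%:R) *m P).
have yE i : co (x.1 - c) i = (i <= 1)%:R by rewrite addrC addKr (co_frame PGP) mxE.
have wE i : co x.2 i = (i != o)%:R by rewrite (co_frame PGP) mxE.
have dE k (A B : 'I_n -> R) : (1 < k)%N ->
    (forall i : 'I_n, (0 < i)%N -> A i * B i = (i <= 1)%:R) ->
    \sum_(i < n | (0 < i < k)%N) A i * B i = 1.
  move=> k1 AB; rewrite (bigD1 o1) ?k1 //= AB // big1 ?addr0 //.
  move=> i /andP[/andP[i0 _] io1]; rewrite AB //.
  by move: i0 io1; rewrite -val_eqE /=; case: (val i) => [|[|m]].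
have rE k : (1 < k)%N -> rho k x = 1.
  by move=> k1; apply: dE => // i _; rewrite yE -natrM mulnb andbb.
have sE k : (1 < k)%N -> sig k x = 1.
  by move=> k1; apply: dE => // i i0; rewrite yE wE ord_firstE i0 mulr1.
exists x; rewrite /minors /axial_minor /axpos /axvel yE wE rE // sE // eqxx /=.
rewrite big1 => [|i i1]; first by rewrite
  !mulr0 !mul0r expr0n /= mulr0 subr0 addr0 expr1n !mulr1 oner_eq0.
rewrite /angular_minor rE 1?ltnW // sE 1?ltnW // yE wE leqNgt i1 ord_firstE.
by rewrite (ltnW i1) mulr0 subr0 mulr1.
Qed.

Let Z1 := c + d *: row o P.
Let Z2 := c + (- d) *: row o P.
Let S := lagrange_system G m1 m2 f Z1 Z2 c.

Lemma integrals_independent : functionally_independent S integrals.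
Proof.
have oT : open (TM S) by exact: open_TM.
have [x0 mx0] := minors_witness.
exists (TM S `&` [set x | minors x != 0]); split.
- apply: openI => //.
  rewrite (_ : mkset _ = minors @^-1` [set r | r != 0]) //.
  apply: open_comp => [x _|]; last exact: open_neq.
  (* Regularity of order 0 is continuity, which makes the set open. *)
  exact: (smooth_minors 0%N).
- by move=> x [].
- exact: line_poly_dense line_poly_minors mx0 oT.
- by move=> x [Tx mx]; apply: minors_lin_indep mx; apply: (TM_regular (f := f) PGP).
Qed.

End Independence.

(** * Confocal quadrics and reflections *)

Section ConfocalAlgebra.
Variables (R : realType) (r1 r2 y s d h : R).
Hypotheses (r1_ge0 : 0 <= r1) (r2_ge0 : 0 <= r2) (s_ge0 : 0 <= s).
Hypothesis r1E : r1 ^+ 2 = (y - d) ^+ 2 + s.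
Hypothesis r2E : r2 ^+ 2 = (y + d) ^+ 2 + s.
Hypothesis h_gt0 : 0 < h.
Local Notation kap := (1 - 4 * d ^+ 2 / h ^+ 2).
Local Notation z := (2 * d * y / h).

Let h0 : h != 0. Proof. by rewrite gt_eqF. Qed.

Let hz : h * z = 2 * d * y. Proof. by field. Qed.

(** On a confocal quadric the distance to a focus is affine in [y] up to sign, namely [h / 2 - z].
    Squaring and using [h * z = 2 * d * y] gives the equation of the quadric. *)
Lemma confocal_focal_radius :
  kap * y ^+ 2 + s = h ^+ 2 / 4 - d ^+ 2 <-> r1 ^+ 2 = (h / 2 - z) ^+ 2.
Proof.
have -> : kap * y ^+ 2 + s = y ^+ 2 + s - z ^+ 2 by field.
have -> : (h / 2 - z) ^+ 2 = h ^+ 2 / 4 - h * z + z ^+ 2 by field.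
by rewrite hz r1E; split=> H; lra.
Qed.

Let r12 : r2 ^+ 2 - r1 ^+ 2 = 2 * (h * z).
Proof. by rewrite hz r1E r2E; ring. Qed.

(** Dividing [r2 ^+ 2 - r1 ^+ 2 = 2 * (h * z)] by the sum [h] gives [r2 - r1 = 2 * z]. Conversely
    the signs of the roots must be recovered: [kap] is positive, so [y ^+ 2 <= h ^+ 2 / 4], which
    bounds [z] by [h / 2] in absolute value. *)
Lemma spheroid_confocal : 2 * `|d| < h ->
  r1 + r2 = h <-> kap * y ^+ 2 + s = h ^+ 2 / 4 - d ^+ 2.
Proof.
move=> dh; rewrite confocal_focal_radius; split=> [H|H].
  have r21 : r2 - r1 = 2 * z.
    apply: (mulfI h0); rewrite -[in LHS]H mulrCA -r12; ring.
  by congr (_ ^+ 2); lra.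
have d2 : 4 * d ^+ 2 < h ^+ 2.
  by rewrite -[d ^+ 2]real_normK ?num_real //; have := normr_ge0 d; nra.
have z2 : z ^+ 2 <= (h / 2) ^+ 2.
  have /confocal_focal_radius E := H.
  have k0 : 0 < kap by rewrite subr_gt0 ltr_pdivrMr ?exprn_gt0 // mul1r.
  have y2 : y ^+ 2 <= h ^+ 2 / 4.
    rewrite -(ler_pM2l k0); apply: (@le_trans _ _ (h ^+ 2 / 4 - d ^+ 2)).
      by rewrite -E lerDl.
    by rewrite le_eqVlt; apply/orP; left; apply/eqP; field.
  have zE : z ^+ 2 = 4 * d ^+ 2 / h ^+ 2 * y ^+ 2 by field.
  rewrite zE.
  have q0 : 0 <= 4 * d ^+ 2 / h ^+ 2.
    by apply: divr_ge0; [apply: mulr_ge0|]; rewrite ?sqr_ge0 ?ler0n.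
  apply: (le_trans (ler_wpM2l q0 y2)).
  have -> : 4 * d ^+ 2 / h ^+ 2 * (h ^+ 2 / 4) = d ^+ 2 by field.
  by rewrite expr_div_n ler_pdivlMr ?exprn_gt0 //; lra.
have h2 : 0 <= h / 2 by rewrite divr_ge0 ?ltW ?ltr0n.
have zh : `|z| <= h / 2.
  by rewrite -(ler_pXn2r (n := 2)) ?nnegrE // real_normK ?num_real.
move: zh; rewrite ler_norml => /andP[zl zu].
have r1z : r1 = h / 2 - z.
  by apply/eqP; rewrite -(eqrXn2 (n := 2)) ?H // subr_ge0.
have r2z : r2 = h / 2 + z.
  apply/eqP; rewrite -(eqrXn2 (n := 2)) //; last by lra.
  apply/eqP; have := r12; rewrite H => /eqP; rewrite subr_eq => /eqP ->.
  by field.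
by rewrite r1z r2z; lra.
Qed.

(** Here [kap] is negative, so the bounds are reversed and [z] is at least [h / 2] in absolute
    value. The sign of [z] selects the sheet, that is, which of the two distances is larger. *)
Lemma hyperboloid_confocal : h < 2 * `|d| ->
  `|r1 - r2| = h <-> kap * y ^+ 2 + s = h ^+ 2 / 4 - d ^+ 2.
Proof.
move=> dh; rewrite confocal_focal_radius; split=> [H|H].
  (* [e] is the sign of [r1 - r2]; it treats both sheets at once. *)
  have [e e2 E] : exists2 e, e ^+ 2 = 1 & r1 - r2 = e * h.
    move: H; case: (ger0P (r1 - r2)) => _ <-.
      by exists 1; rewrite ?expr1n ?mul1r.
    by exists (- 1); rewrite ?sqrrN ?expr1n // mulN1r opprK.
  have r21 : r1 + r2 = - 2 * e * z.
    apply: (mulfI h0); transitivity (e ^+ 2 * (h * (r1 + r2))).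
      by rewrite e2 mul1r.
    transitivity (e * ((e * h) * (r1 + r2))); first by ring.
    transitivity (- e * (2 * (h * z))); last by ring.
    by rewrite -r12 -E; ring.
  have -> : r1 = e * (h / 2 - z) by lra.
  by rewrite exprMn e2 mul1r.
have d2 : h ^+ 2 < 4 * d ^+ 2.
  by rewrite -[d ^+ 2]real_normK ?num_real //; have := normr_ge0 d; have := h_gt0; nra.
have z2 : (h / 2) ^+ 2 <= z ^+ 2.
  have /confocal_focal_radius E := H.
  have k0 : kap < 0 by rewrite subr_lt0 ltr_pdivlMr ?exprn_gt0 // mul1r.
  have y2 : h ^+ 2 / 4 <= y ^+ 2.
    rewrite -(ler_nM2l k0); apply: (@le_trans _ _ (h ^+ 2 / 4 - d ^+ 2)).
      by rewrite -E lerDl.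
    by rewrite le_eqVlt; apply/orP; left; apply/eqP; field.
  have zE : z ^+ 2 = 4 * d ^+ 2 / h ^+ 2 * y ^+ 2 by field.
  rewrite zE.
  have q0 : 0 <= 4 * d ^+ 2 / h ^+ 2.
    by apply: divr_ge0; [apply: mulr_ge0|]; rewrite ?sqr_ge0 ?ler0n.
  apply: le_trans (ler_wpM2l q0 y2).
  have -> : 4 * d ^+ 2 / h ^+ 2 * (h ^+ 2 / 4) = d ^+ 2 by field.
  by rewrite expr_div_n ler_pdivrMr ?exprn_gt0 //; lra.
have h2 : 0 <= h / 2 by rewrite divr_ge0 ?ltW ?ltr0n.
have zh : h / 2 <= `|z|.
  by rewrite -(ler_pXn2r (n := 2)) ?nnegrE // real_normK ?num_real.
have H2 : r2 ^+ 2 = (h / 2 + z) ^+ 2.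
  have := r12; rewrite H => /eqP; rewrite subr_eq => /eqP ->.
  by field.
have [z0|z0] := lerP 0 z.
  rewrite ger0_norm // in zh.
  have -> : r1 = z - h / 2.
    by apply/eqP; rewrite -(eqrXn2 (n := 2)) ?H //; [apply/eqP; ring|lra].
  have -> : r2 = h / 2 + z by apply/eqP; rewrite -(eqrXn2 (n := 2)) ?H2 //; lra.
  have -> : z - h / 2 - (h / 2 + z) = - h by field.
  by rewrite normrN gtr0_norm.
rewrite ltr0_norm // in zh.
have -> : r1 = h / 2 - z by apply/eqP; rewrite -(eqrXn2 (n := 2)) ?H //; lra.
have -> : r2 = - z - h / 2.
  by apply/eqP; rewrite -(eqrXn2 (n := 2)) ?H2 //; [apply/eqP; ring|lra].
have -> : h / 2 - z - (- z - h / 2) = h by field.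
by rewrite gtr0_norm.
Qed.

End ConfocalAlgebra.

(** * Tangent spaces of confocal quadrics and invariance under reflection *)

Section Walls.
Variables (R : realType) (n : nat) (n_ge3 : (3 <= n)%N) (P : 'M[R]_n).
Variables (c : 'rV[R]_n) (d : R) (G : 'M[R]_n).
Local Notation V := 'rV[R]_n.
Local Notation o := (ord_first n_ge3).
Local Notation co := (co P).
Local Notation dotk := (dotk P).
Hypothesis PGP : P *m G *m P^T = 1%:M.

Let Z1 := c + d *: row o P.
Let Z2 := c + (- d) *: row o P.

Definition axial_quadric (kap K : R) : set V :=
  [set q | kap * co (q - c) o ^+ 2 + dotk n (q - c) (q - c) = K].

Lemma gnorm_focus e q :
  Defs.gnorm G (q - (c + e *: row o P)) = Num.sqrt (sqdist n_ge3 P c e (q, 0)).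
Proof. by rewrite /Defs.gnorm -(inner_sqdist _ _ PGP). Qed.

Lemma dist_foci : Defs.gnorm G (Z1 - Z2) = 2 * `|d|.
Proof.
rewrite /Z2 gnorm_focus /sqdist /axpos /rho /Z1 /= (addrC c) addrK.
rewrite dotkZl dotkZr (dotk_axis n_ge3 PGP) coZ (co_axis n_ge3 PGP) eqxx mulr1.
rewrite !mulr0 addr0 (_ : d - - d = 2 * d); last by ring.
rewrite sqrtr_sqr normrM.
by rewrite ger0_norm ?ler0n.
Qed.

(** [K] is [h ^+ 2 / 4 - d ^+ 2], nonzero because [h] differs from the distance of the foci. The
    relation between [kap] and [K] is what singles out confocal quadrics among those with this axis;
    it is used for [second_integral]. *)
Lemma confocal_axial_quadric B : confocal_quadric G Z1 Z2 B ->
  exists kap K, [/\ K != 0, (1 - kap) * K = kap * d ^+ 2 &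
                    B = axial_quadric kap K].
Proof.
move=> [_ H].
have [h [h0 hd BE]] : exists h, [/\ 0 < h, h ^+ 2 != 4 * d ^+ 2 &
    B = axial_quadric (1 - 4 * d ^+ 2 / h ^+ 2) (h ^+ 2 / 4 - d ^+ 2)].
  have r1E q : Num.sqrt (sqdist n_ge3 P c d (q, 0)) ^+ 2
      = (co (q - c) o - d) ^+ 2 + dotk n (q - c) (q - c).
    by rewrite sqr_sqrtr ?addr_ge0 ?sqr_ge0 ?dotk_ge0.
  have r2E q : Num.sqrt (sqdist n_ge3 P c (- d) (q, 0)) ^+ 2
      = (co (q - c) o + d) ^+ 2 + dotk n (q - c) (q - c).
    by rewrite sqr_sqrtr /sqdist opprK // addr_ge0 ?sqr_ge0 ?dotk_ge0.
  have d4 : 4 * d ^+ 2 = (2 * `|d|) ^+ 2.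
    by rewrite exprMn real_normK ?num_real // -natrX.
  case: H => -[h]; rewrite dist_foci => hd ->; exists h.
    have h0 : 0 < h by apply: le_lt_trans hd; rewrite mulr_ge0.
    split=> //.
      by rewrite d4 eqrXn2 ?mulr_ge0 ?(ltW h0) // gt_eqF.
    apply/funext => q; apply/propext.
    rewrite /spheroid /axial_quadric /= !gnorm_focus.
    exact: spheroid_confocal (sqrtr_ge0 _) (sqrtr_ge0 _) (dotk_ge0 _ _ _)
      (r1E q) (r2E q) h0 hd.
  have /andP[h0 hd'] := hd; split=> //.
    by rewrite d4 eqrXn2 ?mulr_ge0 ?(ltW h0) // lt_eqF.
  apply/funext => q; apply/propext.
  rewrite /circular_hyperboloid /axial_quadric /= !gnorm_focus.
  exact: hyperboloid_confocal (sqrtr_ge0 _) (sqrtr_ge0 _) (dotk_ge0 _ _ _)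
    (r1E q) (r2E q) h0 hd'.
exists (1 - 4 * d ^+ 2 / h ^+ 2), (h ^+ 2 / 4 - d ^+ 2); split=> //.
  apply: contra hd => /eqP E; apply/eqP.
  have E4 : 4 * (h ^+ 2 / 4 - d ^+ 2) = 0 by rewrite E mulr0.
  by apply: subr0_eq; rewrite -[RHS]E4; field.
by field; rewrite gt_eqF.
Qed.

Variables (kap K : R).
Hypothesis K0 : K != 0.

(* The normal of the quadric at the point of position [u] from the center. *)
Definition normal (u : V) : V := u + ((kap - 1) * co u o) *: row o P.

Lemma co_normal u : co (normal u) o = kap * co u o.
Proof. by rewrite coD coZ (co_axis n_ge3 PGP) eqxx mulr1; ring. Qed.

Lemma dotk_normal k w u : dotk k w (normal u) = dotk k w u.
Proof. by rewrite dotkDr dotkZr (dotk_axis n_ge3 PGP) mulr0 addr0. Qed.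

Lemma inner_normal w u :
  inner G w (normal u) = kap * (co w o * co u o) + dotk n w u.
Proof. by rewrite (inner_axis n_ge3 PGP) co_normal dotk_normal; ring. Qed.

Let Phi (x : V * V) := kap * axpos n_ge3 P c x ^+ 2 + rho P c n x.

Lemma tangent_normal q w : axial_quadric kap K q ->
  tangent (axial_quadric kap K) q w -> inner G w (normal (q - c)) = 0.
Proof.
move=> _ [gam [g0 gB [dg gw]]].
have dPhi := rgradD (rgradZ kap (rgrad_sqr (rgrad_axpos n_ge3 P c n (q, 0))))
  (rgrad_rho n_ge3 P c n (q, 0)).
have dgam : is_diff (0 : R) (fun t => (gam t, 0 : V)) (fun h => (h *: w, 0)).
  have := is_diff_pair (is_diff_curve dg) (is_diff_cst (0 : V) (0 : R)).
  by rewrite derive1E gw.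
rewrite /rgrad -g0 in dPhi.
have dPg := @is_diff_comp R _ _ _ _ _ _ _ (0 : R) dgam dPhi.
have nearK : \forall t \near (0 : R), (Phi \o (fun t => (gam t, 0 : V))) t = K.
  by apply: filterS gB => t.
(* [Phi] along the curve is constant near 0, so the differential given by the chain rule equals that
   of a constant. *)
have dK := near_eq_is_diff nearK dPg.
have [_ E1] := dK; have [_ E2] := is_diff_const (0 : R) K.
have /(congr1 (@^~ (1 : R))) := etrans (esym E1) E2.
rewrite /= !scale1r g0 /axpos /= !(mul0r, mulr0, addr0, add0r) => E.
apply: (mulfI (_ : 2 != 0)); first by rewrite pnatr_eq0.
by rewrite mulr0 -[RHS]E inner_normal (dotkC _ _ w); ring.
Qed.

(* The curve [c + (u + t w) / sqrt (1 + e t ^ 2)] stays on the quadric, because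
   the conjugacy of [u] and [w] makes the numerator satisfy the homogeneous
   equation with [K (1 + e t ^ 2)]. *)
Lemma normal_tangent q w : axial_quadric kap K q ->
  inner G w (normal (q - c)) = 0 -> tangent (axial_quadric kap K) q w.
Proof.
rewrite inner_normal {1}/axial_quadric /=; move E: (q - c) => u Bq wu.
pose e := (kap * co w o ^+ 2 + dotk n w w) / K.
pose s (t : R) := (Num.sqrt (1 + e * (t * t)))^-1.
have dt : is_diff (0 : R) (fun t => 1 + e * (t * t)) (fun=> 0).
  have di : is_diff (0 : R) (fun t : R => t) (fun h => h) := is_diff_id _.
  apply: is_diff_eq (is_diffD_pt (is_diff_const (0 : R) 1)
    (is_diffM_pt (is_diff_const (0 : R) e) (is_diffM_pt di di))) _.
  by apply/funext => h /=; ring.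
have pos0 : 0 < 1 + e * (0 * 0) by rewrite !mulr0 addr0.
have s0 : s 0 = 1 by rewrite /s !mulr0 addr0 sqrtr1 invr1.
have ds : is_diff (0 : R) s (fun=> 0).
  have := @is_diff_sqrtV R _ (0 : R) (fun t => 1 + e * (t * t)) _ pos0 dt.
  move/is_diff_eq; apply.
  by apply/funext => h; rewrite mulr0.
exists (fun t => c + s t *: (u + t *: w)); split.
- by rewrite s0 scale1r scale0r addr0 -E addrC subrK.
- near=> t.
  have tp : 0 < 1 + e * (t * t).
    near: t.
    have [dt1 _] := dt.
    exact: (cvgr_gt _ (differentiable_continuous dt1) _ pos0).
  rewrite /axial_quadric /= (addrC c) addrK.
  rewrite coZ coD coZ dotkZl dotkZr dotkDl !dotkDr !dotkZl !dotkZr (dotkC _ _ u w).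
  rewrite -(_ : (1 + e * (t * t)) * s t ^+ 2 * K = K); last first.
    by rewrite /s exprVn sqr_sqrtr ?ltW // mulfV ?gt_eqF // mul1r.
  have eK : e * K = kap * co w o ^+ 2 + dotk n w w by rewrite /e divfK.
  transitivity (s t ^+ 2 * ((kap * co u o ^+ 2 + dotk n u u)
     + 2 * t * (kap * (co w o * co u o) + dotk n w u) + t ^+ 2 * (e * K))).
    by rewrite eK; ring.
  by rewrite wu Bq; ring.
(* [s] has value 1 and derivative 0 at 0, so the curve has velocity [w] there. *)
- have dst : is_diff (0 : R) (fun t => s t * t) id.
    apply: is_diff_eq (is_diffM_pt ds (is_diff_id _)) _.
    by apply/funext => h; rewrite s0 mulr0 addr0 mul1r.
  have dg : is_diff (0 : R) (fun t => c + s t *: (u + t *: w)) (fun h => h *: w).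
    have -> : (fun t => c + s t *: (u + t *: w)) =
        cst c + (( *:%R^~ u \o s) + ( *:%R^~ w \o (fun t => s t * t))).
      by apply/funext => t; rewrite !fctE /= scalerDr scalerA.
    have d1 := is_diff_comp ds (is_diff_scalel (s 0) u).
    have d2 := is_diff_comp dst (is_diff_scalel (s 0 * 0) w).
    apply: is_diff_eq (is_diffD (is_diff_cst c (0 : R)) (is_diffD d1 d2)) _.
    by apply/funext => h; rewrite !fctE /= scale0r !add0r.
  have [dg1 dg2] := dg; split; first by apply/derivable1_diffP; exact: dg1.
  by rewrite deriveE // dg2 scale1r.
Unshelve. all: by end_near. Qed.

Variable S : mech_system R n.
Hypothesis metricS : metric S = G.

(** Tangent vectors are exactly those orthogonal to [normal]. So [vn] minus its projection on the
    normal is tangent, orthogonal to [vn] and to the normal, hence to itself, and vanishes. *)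
Lemma reflection_normal q v v' : axial_quadric kap K q ->
  reflection S (axial_quadric kap K) q v v' -> exists t lam,
    [/\ kap * (co t o * co (q - c) o) + dotk n t (q - c) = 0,
        v = t + lam *: normal (q - c) & v' = t - lam *: normal (q - c)].
Proof.
move=> Bq [t [vn [tt nt -> ->]]]; rewrite metricS in nt.
have tN := tangent_normal Bq tt.
set N := normal (q - c) in tN *.
have innC u w : inner G u w = inner G w u.
  by rewrite !(inner_co PGP); apply: eq_bigr => i _; rewrite mulrC.
have innB u w w' a : inner G u (w - a *: w') = inner G u w - a * inner G u w'.
  rewrite !(inner_co PGP) mulr_sumr -sumrB; apply: eq_bigr => i _.
  by rewrite coB coZ; ring.
(* The inner product of the normal with the position [q - c] is [K], which is nonzero. *)
have NN0 : inner G N N != 0.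
  rewrite gt_eqF // (inner_gt0 PGP) //; apply: contra K0 => /eqP N0.
  have := inner_normal (q - c) (q - c); rewrite -/N N0 -expr2 Bq => <-.
  by apply/eqP; rewrite (inner_co PGP); apply: big1 => i _; rewrite co0 mulr0.
pose lam := inner G vn N / inner G N N; exists t, lam.
suff vnE : vn = lam *: N by split; rewrite -?vnE // -inner_normal.
pose u := vn - lam *: N.
have uN : inner G u N = 0.
  by rewrite innC innB innC /lam divfK // subrr.
have uu : inner G u u = 0.
  by rewrite {2}/u innB uN mulr0 subr0 innC; apply: nt; exact: normal_tangent.
apply/eqP; rewrite -subr_eq0; apply/eqP/eqP/negP => /negP u0.
by have := inner_gt0 PGP u0; rewrite uu ltxx.
Qed.

Hypothesis kapK : (1 - kap) * K = kap * d ^+ 2.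

(** For [energy], tangent and normal parts are orthogonal. For [angular], the off-axis part of the
    normal is that of the position, and adding a multiple of the position to the velocity does not
    change a Gram determinant. For [second_integral], the cross term vanishes by [kapK]. *)
Lemma integrals_reflection beta m1 m2 f i :
  reflection_invariant S (axial_quadric kap K)
    (integrals n_ge3 P c d beta m1 m2 f i).
Proof.
move=> q v v' _ Bq /(reflection_normal Bq) [t [lam [tN -> ->]]].
move: Bq tN; rewrite /axial_quadric /=; move E: (q - c) => y Bq tN.
have NE k w : dotk k w (normal y) = dotk k w y := dotk_normal k w y.
move: (normal y) (co_normal y) NE => N cN NE.
have NE' k w : dotk k N w = dotk k y w by rewrite dotkC NE dotkC.
have sigE k a : sig P c k (q, t + a *: N) = dotk k y t + a * dotk k y y.
  by rewrite /sig /= E dotkDr dotkZr NE.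
have tauE k a : tau P k (q, t + a *: N) =
    dotk k t t + 2 * a * dotk k y t + a ^+ 2 * dotk k y y.
  by rewrite /tau /= dotkDl !dotkDr !dotkZl !dotkZr !NE !NE' (dotkC _ _ t y); ring.
have velE a : axvel n_ge3 P (q, t + a *: N) = co t o + a * (kap * co y o).
  by rewrite /axvel coD coZ cN.
have rhoE k w : rho P c k (q, w) = dotk k y y by rewrite /rho /= E.
have posE w : axpos n_ge3 P c (q, w) = co y o by rewrite /axpos /= E.
have kepE m e w w' : kepler n_ge3 P c m e (q, w) = kepler n_ge3 P c m e (q, w').
  by [].
rewrite -scaleNr /integrals; case: (val i) => [|[|k]].
- rewrite /energy /potential !velE !tauE !rhoE !posE.
  rewrite !(kepE _ _ (t + lam *: N) (t + (- lam) *: N)).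
  have -> : dotk n y t = - (kap * (co t o * co y o)).
    by apply/eqP; rewrite -addr_eq0 dotkC addrC tN.
  by field.
- rewrite /second_integral !velE !tauE !sigE !rhoE !posE.
  rewrite !(kepE _ _ (t + lam *: N) (t + (- lam) *: N)).
  have -> : dotk n y t = - (kap * (co t o * co y o)).
    by apply/eqP; rewrite -addr_eq0 dotkC addrC tN.
  have -> : dotk n y y = K - kap * co y o ^+ 2.
    by apply/eqP; rewrite eq_sym subr_eq addrC; apply/eqP/esym.
  (* The difference of the values before and after reflection, once [dotk n y t] and [dotk n y y]
     are replaced using tangency and the equation of the quadric. *)
  apply: subr0_eq; transitivity (2 * beta * lam * co t o * co y o
      * (kap * d ^+ 2 - (1 - kap) * K)); first by field.
  by rewrite kapK subrr mulr0.
- by rewrite /angular !sigE !tauE !rhoE; ring.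
Qed.

End Walls.

(** * Euclidean and normalized models *)

Section LagrangeIdentity.
Variables (R : numFieldType) (n : nat) (Q : pred 'I_n) (x y : 'I_n -> R).

Lemma lagrange_identity :
  \sum_(i < n | Q i) \sum_(j < n | Q j && (i < j)%N) (x i * y j - x j * y i) ^+ 2
  = (\sum_(i < n | Q i) x i ^+ 2) * (\sum_(i < n | Q i) y i ^+ 2)
    - (\sum_(i < n | Q i) x i * y i) ^+ 2.
Proof.
pose A i j := (x i * y j - x j * y i) ^+ 2.
pose L (i j : 'I_n) := if (i < j)%N then A i j else 0.
have AL (i j : 'I_n) : A i j = L i j + L j i.
  rewrite /L /A; case: ltngtP => [ij|ij|/val_inj ->].
  - by rewrite addr0.
  - by rewrite add0r; ring.
  - by ring.
have LE : \sum_(i < n | Q i) \sum_(j < n | Q j && (i < j)%N) A i j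
    = \sum_(i < n | Q i) \sum_(j < n | Q j) L i j.
  by apply: eq_bigr => i _; rewrite big_mkcondr.
(* Doubling turns the sum over [i < j] into the full double sum, which is symmetric with zero
   diagonal. *)
rewrite LE; apply: (mulfI (_ : 2 != 0)); first by rewrite pnatr_eq0.
transitivity (\sum_(i < n | Q i) \sum_(j < n | Q j) A i j).
  rewrite mulr_natl mulr2n [X in _ + X]exchange_big -big_split.
  apply: eq_bigr => i _; rewrite -big_split.
  by apply: eq_bigr => j _; rewrite AL.
have prodE (u v : 'I_n -> R) : (\sum_(i < n | Q i) u i) * (\sum_(j < n | Q j) v j)
    = \sum_(i < n | Q i) \sum_(j < n | Q j) u i * v j.
  by rewrite mulr_suml; apply: eq_bigr => i _; rewrite mulr_sumr.
set X := \sum_(i < n | Q i) x i ^+ 2; set Y := \sum_(i < n | Q i) y i ^+ 2.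
set C := \sum_(i < n | Q i) x i * y i.
transitivity (X * Y + Y * X - C * C - C * C); last by ring.
rewrite !prodE -big_split -!sumrB; apply: eq_bigr => i _ /=.
rewrite -big_split -!sumrB; apply: eq_bigr => j _ /=.
by rewrite /A; ring.
Qed.

End LagrangeIdentity.

Lemma mulmx_tr_gt0 (R : realType) (n : nat) (u : 'rV[R]_n) :
  u != 0 -> 0 < (u *m u^T) 0 0.
Proof.
have P1 : 1%:M *m 1%:M *m (1%:M)^T = 1%:M :> 'M[R]_n by rewrite trmx1 !mulmx1.
by move=> /(inner_gt0 P1); rewrite /inner mulmx1.
Qed.

(* The Householder reflection exchanging [u] and the [o]-th basis vector. *)
Lemma orthonormal_extension (R : realType) (n : nat) (o : 'I_n) (u : 'rV[R]_n) :
  (u *m u^T) 0 0 = 1 -> exists2 P : 'M[R]_n, P *m P^T = 1%:M & row o P = u.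
Proof.
move=> u1; pose e : 'rV[R]_n := delta_mx 0 o.
have [h hE] : exists h, h = u - e by exists (u - e).
have [h0|h0] := eqVneq h 0.
  exists 1%:M; first by rewrite trmx1 mulmx1.
  by rewrite row1 -/e; apply/esym/subr0_eq; rewrite -hE.
pose s : R := (h *m h^T) 0 0.
have hh : h *m h^T = s%:M by rewrite [LHS]mx11_scalar.
have s0 : s != 0 by rewrite gt_eqF // mulmx_tr_gt0.
have ue : (u *m e^T) 0 0 = u 0 o by rewrite trmx_delta -colE mxE.
have eu (v : 'rV[R]_n) : (e *m v^T) 0 0 = v 0 o by rewrite -rowE !mxE.
have dBl (v v' w : 'rV[R]_n) :
    ((v - v') *m w^T) 0 0 = (v *m w^T) 0 0 - (v' *m w^T) 0 0.
  by rewrite mulmxBl [LHS]mxE [X in _ + X]mxE.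
have dBr (v v' w : 'rV[R]_n) :
    (w *m (v - v')^T) 0 0 = (w *m v^T) 0 0 - (w *m v'^T) 0 0.
  by rewrite linearB /= mulmxBr [LHS]mxE [X in _ + X]mxE.
(* Both vectors are unit, so the squared length of [h] is [2 - 2 * u 0 o]; this makes
   [2 / s * h 0 o] equal to -1 below. *)
have sE : s = - 2 * (u 0 o - 1).
  by rewrite /s hE dBl !dBr u1 ue !eu /e [delta_mx _ _ _ _]mxE !eqxx /= mulr1n; ring.
pose P := 1%:M - (2 / s) *: (h^T *m h).
have PT : P^T = P.
  by rewrite /P linearB /= trmx1 linearZ /= trmx_mul trmxK.
exists P.
  rewrite PT /P mulmxBl mul1mx mulmxBr mulmx1 -scalemxAl -scalemxAr.
  rewrite -(mulmxA h^T) (mulmxA h) hh mul_scalar_mx -scalemxAr !scalerA.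
  have -> : 2 / s * (2 / s * s) = 2 / s + 2 / s by field.
  rewrite scalerDl; move: (_ *: _) => X.
  by rewrite (opprD X X) (addrA X) subrr sub0r opprK subrK.
rewrite rowE -/e /P mulmxBr mulmx1 -scalemxAr mulmxA [e *m h^T]mx11_scalar eu.
rewrite mul_scalar_mx scalerA (_ : 2 / s * h 0 o = - 1).
  by rewrite scaleN1r opprK hE addrC subrK.
have -> : h 0 o = u 0 o - 1 by rewrite hE !mxE !eqxx.
have := s0; rewrite sE => s0'; field.
by apply: contra s0' => /eqP ->; rewrite mulr0.
Qed.

(** * Integrability in a frame adapted to the foci *)

Section Integrability.
Variables (R : realType) (n : nat) (n_ge3 : (3 <= n)%N) (P G : 'M[R]_n).
Variables (c : 'rV[R]_n) (d beta m1 m2 f : R).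
Local Notation o := (ord_first n_ge3).
Hypothesis PGP : P *m G *m P^T = 1%:M.
Hypothesis beta0 : beta != 0.

(** Stated for any orthonormal frame whose axial vector carries the foci, so that the Euclidean and
    the normalized models are both instances. *)
Lemma lagrange_integrates k (B : 'I_k -> set 'rV[R]_n) :
  (forall j, confocal_quadric G (c + d *: row o P) (c + (- d) *: row o P) (B j)) ->
  integrates (lagrange_system G m1 m2 f (c + d *: row o P) (c + (- d) *: row o P) c)
    B (integrals n_ge3 P c d beta m1 m2 f).
Proof.
move=> BC; split.
- exact: integrals_smooth.
- exact: integrals_first_integral.
- exact: integrals_independent.
- move=> i j x Tx; apply: (involution _ _ PGP) => //.
  exact: (TM_regular (f := f) PGP).
- move=> i j; have [kap [K [K0 kapK ->]]] := confocal_axial_quadric PGP (BC j).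
  by apply: (integrals_reflection PGP K0 _ kapK).
Qed.

End Integrability.

(** * Subcases of the Lagrange problem as equalities of mechanical systems *)

Section Subsystems.
Variables (R : realType) (n : nat) (G : 'M[R]_n).
Implicit Types (m f : R) (Z : 'rV[R]_n).

Lemma lagrange_two_center m1 m2 Z1 Z2 Z0 :
  lagrange_system G m1 m2 0 Z1 Z2 Z0 = two_center_system G m1 m2 Z1 Z2.
Proof.
by congr MechSystem; apply/funext => q; rewrite mul0r addr0.
Qed.

(** A center of zero mass has an empty singular set, so the configuration spaces agree as well as
    the forces. *)
Lemma two_center_kepler1 m Z1 Z2 :
  two_center_system G m 0 Z1 Z2 = kepler_system G m Z1.
Proof.
rewrite /two_center_system kepler_sing0 setU0; congr MechSystem.
by apply/funext => q; rewrite mul0r addr0.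
Qed.

Lemma two_center_kepler2 m Z1 Z2 :
  two_center_system G 0 m Z1 Z2 = kepler_system G m Z2.
Proof.
rewrite /two_center_system kepler_sing0 set0U; congr MechSystem.
by apply/funext => q; rewrite mul0r add0r.
Qed.

Lemma lagrange_hooke f Z1 Z2 Z0 :
  lagrange_system G 0 0 f Z1 Z2 Z0 = hooke_system G f Z0.
Proof.
rewrite /lagrange_system !kepler_sing0 setU0 setC0; congr MechSystem.
by apply/funext => q; rewrite !mul0r !add0r.
Qed.

End Subsystems.

(** The axial frame vector is the unit vector along [Z1 - Z2]; the foci then have abscissas [L / 2]
    and [- (L / 2)] from the midpoint, and [beta] is taken to be 1. *)
Lemma euclidean_lagrange_integrable (R : realType) (n : nat) (Z1 Z2 : 'rV[R]_n)
    (m1 m2 f : R) (k : nat) (B : 'I_k -> set 'rV[R]_n) :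
  (3 <= n)%N -> Z1 <> Z2 ->
  (forall j, confocal_quadric (euclidean R n) Z1 Z2 (B j)) ->
  integrable_billiard
    (lagrange_system (euclidean R n) m1 m2 f Z1 Z2 (midpoint Z1 Z2)) B.
Proof.
move=> n_ge3 Z12 BC; pose w := Z1 - Z2; pose L := Num.sqrt ((w *m w^T) 0 0).
have ww : 0 < (w *m w^T) 0 0.
  by apply: mulmx_tr_gt0; rewrite subr_eq0; apply/eqP.
have L0 : 0 < L by rewrite sqrtr_gt0.
have [|P PP rP] := @orthonormal_extension R n (ord_first n_ge3) (L^-1 *: w).
  rewrite linearZ /= -scalemxAl -scalemxAr scalerA mxE -invfM -expr2.
  by rewrite sqr_sqrtr ?mulVf ?gt_eqF // ltW.
have PGP : P *m euclidean R n *m P^T = 1%:M by rewrite mulmx1.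
have dw : (L / 2) *: row (ord_first n_ge3) P = 2^-1 *: w.
  by rewrite rP scalerA; congr (_ *: _); field; rewrite gt_eqF.
have half (u : 'rV[R]_n) : 2^-1 *: (u + u) = u.
  by rewrite scalerDr -scalerDl (_ : 2^-1 + 2^-1 = 1) ?scale1r //; field.
have Z1E : midpoint Z1 Z2 + (L / 2) *: row (ord_first n_ge3) P = Z1.
  by rewrite dw /midpoint -scalerDr /w addrACA subrr addr0 half.
have Z2E : midpoint Z1 Z2 + (- (L / 2)) *: row (ord_first n_ge3) P = Z2.
  by rewrite scaleNr dw /midpoint -scalerBr /w opprB (addrC Z1) addrACA subrr addr0 half.
have := lagrange_integrates (n_ge3 := n_ge3) (c := midpoint Z1 Z2) (d := L / 2) m1 m2 f
  PGP (oner_neq0 R) (k := k) (B := B).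
rewrite Z1E Z2E => /(_ BC) I; eexists; exact: I.
Qed.

(** * The explicit first integrals of the normalized model *)

Section Normalized.
Variables (R : realType) (n : nat) (n_ge3 : (3 <= n)%N) (a m1 m2 f : R).
Local Notation o := (ord_first n_ge3).
Local Notation V := 'rV[R]_n.

Let s : R := Num.sqrt (1 + a ^+ 2).

Let a21 : 0 < 1 + a ^+ 2.
Proof. by rewrite ltr_pwDl ?sqr_ge0. Qed.

Let s_gt0 : 0 < s. Proof. by rewrite sqrtr_gt0. Qed.

Let s0 : s != 0. Proof. by rewrite gt_eqF. Qed.

Let s2 : s ^+ 2 = 1 + a ^+ 2. Proof. by rewrite sqr_sqrtr ?ltW. Qed.

(** The first basis vector has squared length [(1 + a ^+ 2)^-1] for [metric_a]; the scaling makes it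
    a unit vector. *)
Definition frame_a : 'M[R]_n :=
  diag_mx (\row_i (if i == o then Num.sqrt (1 + a ^+ 2) else 1)).

Lemma frame_a_orthonormal : frame_a *m metric_a n_ge3 a *m frame_a^T = 1%:M.
Proof.
rewrite /metric_a -/s tr_diag_mx !mulmx_diag -diag_const_mx; congr diag_mx.
apply/rowP => i; rewrite !mxE; case: eqP => _; last by rewrite !mulr1.
by rewrite -/s -s2; field.
Qed.

Lemma co_frame_a u i : co frame_a u i = if i == o then u 0 i / s else u 0 i.
Proof.
have uE : u = (\row_j (if j == o then u 0 j / s else u 0 j)) *m frame_a.
  apply/rowP => j; rewrite mul_mx_diag !mxE -/s.
  by case: eqP => _; rewrite ?mulr1 // divfK.
by rewrite {1}uE (co_frame frame_a_orthonormal) mxE.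
Qed.

Lemma dotk_frame_a k u w :
  dotk frame_a k u w = \sum_(i < n | (0 < i < k)%N) u 0 i * w 0 i.
Proof.
apply: eq_bigr => i /andP[i0 _]; rewrite !co_frame_a.
by rewrite (negPf (_ : i != o)) // ord_firstE.
Qed.

Lemma row_frame_a (d : R) : 0 + (d / s) *: row o frame_a
  = \row_i (if i == o then d else 0).
Proof.
apply/rowP => i; rewrite !mxE add0r [_ == i]eq_sym.
case: (eqVneq i (ord_first n_ge3)) => _; last by rewrite mulr0n mulr0.
by rewrite eqxx mulr1n -/s divfK.
Qed.

(** [lagrange_identity] on the indices [0 < i < k]; the terms of [C_int] with [k <= i] have an empty
    inner sum. *)
Lemma C_int_angular k x : C_int k x = angular frame_a 0 k x.
Proof.
case: x => q v; rewrite /C_int /angular /rho /sig /tau /= subr0 !dotk_frame_a.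
have := @lagrange_identity R n (fun i => 0 < i < k)%N (fun i => q 0 i) (fun i => v 0 i).
move=> <-; rewrite (bigID (fun i : 'I_n => (i < k)%N)) /= [X in _ + X]big1 ?addr0.
  apply: eq_bigr => i /andP[i0 ik].
  apply: eq_big => [j|j _]; last by rewrite [v 0 i * _]mulrC.
  by case: (ltnP i j) => ij; rewrite ?andbT ?andbF // (leq_ltn_trans _ ij).
move=> i /andP[_ ik]; apply: big1 => j /andP[ij jk].
by move: ik; rewrite (ltn_trans ij jk).
Qed.

Lemma norm_a_sqr u : norm_a n_ge3 a u ^+ 2 = (u 0 o / s) ^+ 2 + dotk frame_a n u u.
Proof.
rewrite /norm_a /Defs.gnorm sqr_sqrtr (inner_axis n_ge3 frame_a_orthonormal).
  by rewrite co_frame_a eqxx expr2.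
by rewrite addr_ge0 ?dotk_ge0 // -expr2 sqr_ge0.
Qed.

Lemma norm_a_focus e q v : norm_a n_ge3 a (q - \row_i (if i == o then e else 0))
  = Num.sqrt (sqdist n_ge3 frame_a 0 (e / s) (q, v)).
Proof.
by rewrite -row_frame_a /norm_a (gnorm_focus n_ge3 _ frame_a_orthonormal).
Qed.

Lemma E_sp_energy : E_sp n_ge3 a m1 m2 f = energy n_ge3 frame_a 0 (a / s) m1 m2 f.
Proof.
apply/funext => -[q v]; rewrite /E_sp /energy /potential /kepler.
rewrite (norm_a_focus a q v) (norm_a_focus (- a) q v) !norm_a_sqr mulNr.
rewrite /axvel /axpos /rho /tau /= subr0 !co_frame_a eqxx.
ring.
Qed.

(** With [s] the root of [1 + a ^+ 2], the first coordinate is [s] times the axial one, each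
    radicand is [s ^+ 2] times a squared distance, the double sum is a Gram determinant by
    [lagrange_identity], and [1 - d ^+ 2 = (s ^+ 2)^-1] for [d = a / s]. *)
Lemma E_sph_second :
  E_sph n_ge3 a m1 m2 f
  = second_integral n_ge3 frame_a 0 (a / s) (1 + a ^+ 2) m1 m2 f.
Proof.
apply/funext => -[q v]; rewrite /E_sph /second_integral /kepler.
have rhoE : \sum_(i < n | i != o) q 0 i ^+ 2 = rho frame_a 0 n (q, v).
  rewrite /rho /= subr0 dotk_frame_a.
  by apply: eq_big => [i|i _]; rewrite ?expr2 // ord_firstE ltn_ord andbT.
have sqE e : (q 0 o - e) ^+ 2 + (1 + a ^+ 2) * rho frame_a 0 n (q, v)
    = s ^+ 2 * sqdist n_ge3 frame_a 0 (e / s) (q, v).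
  by rewrite /sqdist /axpos /= subr0 co_frame_a eqxx -s2; field.
have sqN : q 0 o + a = q 0 o - - a by rewrite opprK.
have sqrtE x : Num.sqrt (s ^+ 2 * x) = s * Num.sqrt x.
  by rewrite sqrtrM ?sqr_ge0 // sqrtr_sqr ger0_norm // ltW.
rewrite rhoE sqN !sqE !sqrtE mulNr -/s.
have := @lagrange_identity R n predT (fun i => q 0 i) (fun i => v 0 i) => /= ->.
have sumE (u w : V) : \sum_i u 0 i * w 0 i = u 0 o * w 0 o + dotk frame_a n u w.
  by rewrite (sum_axisT n_ge3) dotk_frame_a.
rewrite !sumE.
have dE : 1 - (a / s) ^+ 2 = (s ^+ 2)^-1.
  by rewrite -[1 in LHS](mulfV (expf_neq0 2 s0)) {1}s2; field.
rewrite dE -s2 !invfM /axvel /axpos /rho /sig /tau /= !subr0 !co_frame_a eqxx.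
move: (Num.sqrt (sqdist _ _ _ _ _))^-1 (Num.sqrt (sqdist _ _ _ (- _) _))^-1.
move: (dotk _ n q q) (dotk _ n q v) (dotk _ n v v) => qq qv vv i1 i2.
by field.
Qed.

Lemma lagrange_integralsE : lagrange_integrals n_ge3 a m1 m2 f
  = integrals n_ge3 frame_a 0 (a / s) (1 + a ^+ 2) m1 m2 f.
Proof.
apply/funext => i; rewrite /lagrange_integrals /integrals.
case: (val i) => [|[|k]]; [exact: E_sp_energy|exact: E_sph_second|].
by apply/funext => x; exact: C_int_angular.
Qed.

Lemma normalized_integrates k (B : 'I_k -> set V) :
  (forall j, confocal_quadric (metric_a n_ge3 a) (Zt1 n_ge3 a) (Zt2 n_ge3 a) (B j)) ->
  integrates (normalized_lagrange n_ge3 a m1 m2 f) B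
    (lagrange_integrals n_ge3 a m1 m2 f).
Proof.
have a0 : 1 + a ^+ 2 != 0 by rewrite gt_eqF.
have := lagrange_integrates (n_ge3 := n_ge3) (c := 0) (d := a / s) m1 m2 f
  frame_a_orthonormal a0 (k := k) (B := B).
by rewrite -lagrange_integralsE -mulNr !row_frame_a.
Qed.

End Normalized.

Theorem theorem5 (R : realType) (n : nat) (n_ge3 : (3 <= n)%N) :
  (forall (Z1 Z2 : 'rV[R]_n) (m1 m2 f : R), Z1 <> Z2 ->
    forall (k : nat) (B : 'I_k -> set 'rV[R]_n),
      (forall j, confocal_quadric (euclidean R n) Z1 Z2 (B j)) ->
      [/\ integrable_billiard
            (lagrange_system (euclidean R n) m1 m2 f Z1 Z2 (midpoint Z1 Z2)) B,
          integrable_billiard (two_center_system (euclidean R n) m1 m2 Z1 Z2) B,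
          integrable_billiard (kepler_system (euclidean R n) m1 Z1) B,
          integrable_billiard (kepler_system (euclidean R n) m2 Z2) B &
          integrable_billiard (hooke_system (euclidean R n) f (midpoint Z1 Z2)) B])
  /\
  (forall (a m1 m2 f : R), a <> 0 ->
    forall (k : nat) (B : 'I_k -> set 'rV[R]_n),
      (forall j, confocal_quadric (metric_a n_ge3 a)
                   (Zt1 n_ge3 a) (Zt2 n_ge3 a) (B j)) ->
      integrates (normalized_lagrange n_ge3 a m1 m2 f) B
        (lagrange_integrals n_ge3 a m1 m2 f)).
Proof.
split=> [Z1 Z2 m1 m2 f Z12 k B BC|a m1 m2 f _ k B]; last exact: normalized_integrates.
(* The masses and the Hooke constant are left free here, so that each subcase comes from setting
   some of them to 0 with the same walls. *)
have L m m' f' : integrable_billiard (lagrange_system (euclidean R n) m m' f'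
    Z1 Z2 (midpoint Z1 Z2)) B by exact: euclidean_lagrange_integrable.
split=> //.
- by have := L m1 m2 0; rewrite lagrange_two_center.
- by have := L m1 0 0; rewrite lagrange_two_center two_center_kepler1.
- by have := L 0 m2 0; rewrite lagrange_two_center two_center_kepler2.
- by have := L 0 0 f; rewrite lagrange_hooke.
Qed.
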